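(* Let $a,c$ be nonzero complex numbers and let $\ell,m,n$ be nonnegative integers. Then $$ {}_4\phi_3\left[\begin{matrix}a,\,c,\,q^{-n},\,-q^{1+\ell+m+n}a/c\\ q^{1+\ell}a/c,\,q^{1+m+n}a,\,-q^{-n}c\end{matrix};q,q\right] =\frac{(a,\,-q^{-\ell}c;q)_\ell}{(q^{-\ell-1}c^2,\,-qa/c;q)_\ell}\, \frac{(q^{1+m+n},\,-qa/c;q)_n}{(q^{1+m+n}a,\,-q/c;q)_n}\sum_{i=0}^{\ell}\sum_{j=0}^{m}T_{i,j}, $$ where $$ T_{i,j}=(-1)^{i+j}q^{\binom{j+1}{2}-nj}\Big(\frac{c}{a}\Big)^i\,\frac{1-q^{1+2i}/c^2}{1-q/c^2}\, \frac{(q^{-\ell},\,q^{1+\ell}a/c^2,\,q/c^2;q)_i}{(q,\,q^{1-\ell}/a,\,q^{2+\ell}/c^2;q)_i} $$ $$ \times\frac{(q^{-m},\,q^{-m-n},\,-q^{-m-n},\,q^{\ell-i}a,\,q^{1+\ell+i}a/c^2;q)_j}{(q,\,q^{1+\ell}a/c,\,-q^{1+\ell}a/c,\,q^{-m-2n},\,q^{j-2m-2n-1};q)_j}\, \frac{(q^{1+\ell-i+j}a,\,q^{2+\ell+i+j}a/c^2;q^2)_{m+n-j}}{(q,\,q^{2+2\ell+2j}a^2/c^2;q^2)_{m+n-j}}. $$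
   Context: $q$ is a nonzero complex number. For complex $x$ and an integer $n\ge 0$, the $q$-shifted factorial is $(x;q)_0=1$, $(x;q)_n=\prod_{k=0}^{n-1}(1-xq^k)$, and $(x_1,\dots,x_r;q)_n=\prod_{s=1}^r (x_s;q)_n$ (likewise with base $q^2$ in place of $q$). The basic hypergeometric series is ${}_4\phi_3\left[\begin{matrix}a_0,a_1,a_2,a_3\\ b_1,b_2,b_3\end{matrix};q,z\right]=\sum_{k\ge0}\frac{(a_0,a_1,a_2,a_3;q)_k}{(q,b_1,b_2,b_3;q)_k}z^k$. Here one upper parameter is $q^{-n}$, so the series terminates and means the sum over $0\le k\le n$. Parameters are assumed to be such that no zero factor appears in a denominator of the displayed expressions. *)

(* Defs.v *)
From HB Require Import structures.
From mathcomp Require Import all_boot all_order all_algebra.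
From mathcomp Require Import reals complex.

Set Implicit Arguments.
Unset Strict Implicit.
Unset Printing Implicit Defensive.

Import Order.TTheory GRing.Theory Num.Theory.

Local Open Scope ring_scope.

Section BasicHypergeometric.
Variable F : fieldType.
Implicit Types (x q z a c : F) (k n : nat).

(* (x;q)_n *)
Definition qpoch x q n : F := \prod_(k < n) (1 - x * q ^+ k).

(* (x_1,...,x_r;q)_n *)
Definition qpochs (xs : seq F) q n : F := \prod_(x <- xs) qpoch x q n.

(* The series 4phi3[a0,a1,a2,a3; b1,b2,b3; q,z] summed over 0 <= k <= n.  It is
   meant for the case where one of the upper parameters is q^(-n): all later
   terms then contain the factor 1 - q^(-n) q^n = 0. *)
Definition phi43 n a0 a1 a2 a3 b1 b2 b3 q z : F :=
  \sum_(k < n.+1)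
    qpochs [:: a0; a1; a2; a3] q k / qpochs [:: q; b1; b2; b3] q k * z ^+ k.

(* The denominators of T_{i,j}, one for each of its four fractions.  The last
   parameter of [Tden_j] depends on j, and [Tden_mnj] has base q^2. *)
Definition Tden_c q c : F := 1 - q / c ^+ 2.

Definition Tden_i q a c (l i : nat) : F :=
  qpochs [:: q; q ^ (1 - l%:Z) / a; q ^+ (2 + l) / c ^+ 2] q i.

Definition Tden_j q a c (l m n j : nat) : F :=
  qpochs [:: q; q ^+ (1 + l) * a / c; - (q ^+ (1 + l) * a / c);
             q ^ (- m%:Z - 2 * n%:Z);
             q ^ (j%:Z - 2 * m%:Z - 2 * n%:Z - 1)] q j.

Definition Tden_mnj q a c (l m n j : nat) : F :=
  qpochs [:: q; q ^+ (2 + 2 * l + 2 * j) * a ^+ 2 / c ^+ 2] (q ^+ 2) (m + n - j).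

(* T_{i,j}, used for 0 <= i <= l and 0 <= j <= m; on this range the natural
   number subtraction m + n - j is the usual one. *)
Definition T q a c (l m n i j : nat) : F :=
  (-1) ^+ (i + j) * q ^ ('C(j.+1, 2)%:Z - n%:Z * j%:Z) * (c / a) ^+ i
  * ((1 - q ^+ (1 + 2 * i) / c ^+ 2) / Tden_c q c)
  * (qpochs [:: q ^ (- l%:Z); q ^+ (1 + l) * a / c ^+ 2; q / c ^+ 2] q i
     / Tden_i q a c l i)
  * (qpochs [:: q ^ (- m%:Z); q ^ (- m%:Z - n%:Z); - q ^ (- m%:Z - n%:Z);
                q ^ (l%:Z - i%:Z) * a; q ^+ (1 + l + i) * a / c ^+ 2] q j
     / Tden_j q a c l m n j)
  * (qpochs [:: q ^ (1 + l%:Z - i%:Z + j%:Z) * a;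
                q ^+ (2 + l + i + j) * a / c ^+ 2] (q ^+ 2) (m + n - j)
     / Tden_mnj q a c l m n j).

End BasicHypergeometric.

(* Main.v *)
Require Import Defs.
From HB Require Import structures.
From mathcomp Require Import all_boot all_order all_algebra.
From mathcomp Require Import reals complex.
From mathcomp Require Import fraction ring zify.
Import Order.TTheory GRing.Theory Num.Theory.
Local Open Scope ring_scope.

(** Sears' transformation turns the left-hand side into a 4phi3 with upper
parameters q^-n, a, q^(l+1) a/c^2, -q^(-m-n) and lower parameters D, -q a/c,
q^(-m-2n), where D = q^(l+1) a/c.  For A = q^(l-i) a and B = q^(l+1+i) a/c^2 the
product A B does not depend on i, and two terminating 6phi5 sums do the rest.
One, over i, expands (a, q^(l+1) a/c^2; q)_k (-q^(k+1) a/c; q)_l in the products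
(A, B; q)_k, which replaces -q a/c by -D.  The other, over j, reduces the
resulting 4phi3[q^-n, A, B, -q^(-m-n); D, -D, q^(-m-2n); q, q] to the case m = 0
with n replaced by m+n-j and A, B, D multiplied by q^j; that case is Andrews'
terminating q-Watson sum, and it gives (q^(1+j) A, q^(1+j) B; q^2)_(m+n-j).

These steps divide by factors 1 - q^k which the hypotheses allow to vanish when
q is a root of unity.  They are therefore carried out in F(X) with q + X in place
of q, and the identity is then specialized at X = 0. *)

Ltac nz := repeat (first [done | apply/andP; split | apply: mulf_neq0
  | apply: expf_neq0 | rewrite oppr_eq0 | rewrite invr_eq0 | rewrite oner_eq0]).

(** * Elementary identities for q-shifted factorials *)

Section ShiftedFactorial.
Set Implicit Arguments.
Unset Strict Implicit.
Variable F : fieldType.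
Implicit Types (x q : F) (k m n : nat).

Lemma qpoch0 x q : qpoch x q 0 = 1.
Proof. by rewrite /qpoch big_ord0. Qed.

Lemma qpochS x q n : qpoch x q n.+1 = qpoch x q n * (1 - x * q ^+ n).
Proof. by rewrite /qpoch big_ord_recr. Qed.

Lemma qpochD x q m n :
  qpoch x q (m + n) = qpoch x q m * qpoch (x * q ^+ m) q n.
Proof.
elim: n => [|n IH]; first by rewrite addn0 qpoch0 mulr1.
by rewrite addnS !qpochS IH exprD !mulrA.
Qed.

Lemma qpochSl x q n : qpoch x q n.+1 = (1 - x) * qpoch (x * q) q n.
Proof. by rewrite -add1n qpochD qpochS qpoch0 expr0 expr1 mulr1 mul1r. Qed.

Lemma qpochB x q n k : (k <= n)%N ->
  qpoch x q n = qpoch x q k * qpoch (x * q ^+ k) q (n - k).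
Proof. by move=> le_kn; rewrite -qpochD subnKC. Qed.

Lemma qpoch_neq0 x q n :
  (qpoch x q n != 0) = [forall k : 'I_n, 1 - x * q ^+ k != 0].
Proof.
apply/idP/forallP => [/prodf_neq0 h k|h]; first exact: h.
by apply/prodf_neq0 => k _; apply: h.
Qed.

Lemma qpoch_neq0W x q n k : (k <= n)%N -> qpoch x q n != 0 -> qpoch x q k != 0.
Proof. by move=> le_kn; rewrite (qpochB _ _ le_kn) mulf_eq0 => /norP[]. Qed.

Lemma qpoch_sqr x q n : qpoch (x ^+ 2) (q ^+ 2) n = qpoch x q n * qpoch (- x) q n.
Proof.
elim: n => [|n IH]; first by rewrite !qpoch0 mulr1.
by rewrite !qpochS IH exprAC; ring.
Qed.

(** Pairing 1 - q^(1-n+k)/x with 1 - x q^(n-1-k) gives the quotient -q^(k+1-n)/x. This handles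
    parameters such as q^(1-l)/a and -q^(-n) c, and carries nonvanishing from one side to the
    other. *)
Lemma qpoch_rev x q n : x != 0 -> q != 0 ->
  qpoch (q / (q ^+ n * x)) q n
  = (- 1 / x) ^+ n / q ^+ 'C(n, 2) * qpoch x q n.
Proof.
move=> x0 q0; elim: n => [|n IH]; first by rewrite !qpoch0 bin0n !expr0 invr1 !mulr1.
rewrite qpochSl qpochS binS bin1 exprD.
have -> : q / (q ^+ n.+1 * x) * q = q / (q ^+ n * x).
  by rewrite exprS; field; nz.
by rewrite IH !exprS; field; nz.
Qed.

(** Kept as a product so that it holds for every nonzero q: (q; q)_(n-k) may vanish at a root of
    unity. *)
Lemma qpoch_neg q n k : q != 0 -> (k <= n)%N ->
  qpoch ((q ^+ n)^-1) q k * qpoch q q (n - k)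
  = (-1) ^+ k * q ^+ 'C(k, 2) / q ^+ (n * k) * qpoch q q n.
Proof.
move=> q0; elim: k => [|k IH] lekn.
  by rewrite qpoch0 bin0n subn0 muln0 !expr0 invr1 !mulr1.
have := IH (ltnW lekn); rewrite (_ : n - k = (n - k.+1).+1)%N; last by lia.
rewrite [qpoch q q (_.+1)]qpochS qpochS binS bin1 mulnS !exprD => {}IH.
have e : q ^+ n = q ^+ (n - k.+1) * q * q ^+ k.
  by rewrite -!exprSr -exprD; congr (_ ^+ _); lia.
have qk0 : q ^+ k != 0 by rewrite expf_neq0.
have qk1 : q ^+ (n - k.+1) != 0 by rewrite expf_neq0.
have -> : 1 - (q ^+ n)^-1 * q ^+ k =
   - (q ^+ k / q ^+ n) * (1 - q * q ^+ (n - k.+1)).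
  by rewrite e; field; nz.
rewrite [X in X = _](_ : _ = - (q ^+ k / q ^+ n) * (qpoch (q ^+ n)^-1 q k *
   (qpoch q q (n - k.+1) * (1 - q * q ^+ (n - k.+1))))); last by ring.
by rewrite IH exprS; field; nz.
Qed.

Lemma qpoch_neg0 q n k : q != 0 -> (n < k)%N -> qpoch ((q ^+ n)^-1) q k = 0.
Proof.
move=> q0 ltnk; apply/eqP; rewrite /qpoch prodf_seq_eq0.
apply/hasP; exists (Ordinal ltnk); first exact: mem_index_enum.
by rewrite /= mulVf ?expf_neq0 // subrr.
Qed.

End ShiftedFactorial.

(** * Gaussian binomials and expansions in the products (A, B; q)_k, for q not a root of unity *)

Section NotRootOfUnity.
Set Implicit Arguments.
Unset Strict Implicit.
Variables (F : fieldType) (q : F).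
Hypotheses (q0 : q != 0) (q1 : forall k, (0 < k)%N -> q ^+ k != 1).
Implicit Types (A B x y a b c d e f : F) (i j k l m n p s : nat).
Local Notation P x n := (qpoch x q n).
Local Notation P2 x n := (qpoch x (q ^+ 2) n).

Let qX k : q ^+ k != 0. Proof. by rewrite expf_neq0. Qed.
Let q1B k : (0 < k)%N -> 1 - q ^+ k != 0.
Proof. by move=> /q1; rewrite subr_eq0 eq_sym. Qed.

Let qq0 n : P q n != 0.
Proof.
by rewrite qpoch_neq0; apply/forallP => k; rewrite -exprS q1B.
Qed.

(** The Gaussian binomial coefficient, set to 0 for k > n so that the two recurrences below hold
    without a bound on k. *)
Definition gbinom n k : F := if (k <= n)%N then P q n / (P q k * P q (n - k)) else 0.

Lemma gbinom0 n : gbinom n 0 = 1.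
Proof. by rewrite /gbinom subn0 qpoch0 mul1r divff. Qed.

Lemma gbinomn n : gbinom n n = 1.
Proof. by rewrite /gbinom leqnn subnn qpoch0 mulr1 divff. Qed.

Lemma gbinom_gt n k : (n < k)%N -> gbinom n k = 0.
Proof. by move=> h; rewrite /gbinom leqNgt h. Qed.

Lemma gbinomSn n k : (1 - q ^+ n.+1 / q ^+ k) * gbinom n.+1 k = (1 - q ^+ n.+1) * gbinom n k.
Proof.
rewrite /gbinom; case: (leqP k n) => h.
  rewrite leqW // subSn // !qpochS.
  have -> : q ^+ n.+1 / q ^+ k = q * q ^+ (n - k).
    by rewrite -exprS -{1}(subnK h) -addSn exprD mulfK.
  have := q1B (ltn0Sn (n - k)); rewrite !exprS => h1.
  by field; nz.
move: h; rewrite leq_eqVlt => /predU1P[<-|h].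
  by rewrite divff // subrr mul0r mulr0.
by rewrite leqNgt h !mulr0.
Qed.

Lemma gbinomSk n k : (1 - q ^+ k.+1) * gbinom n.+1 k.+1 = (1 - q ^+ n.+1) * gbinom n k.
Proof.
rewrite /gbinom ltnS subSS; case: leqP => h; last by rewrite !mulr0.
rewrite !qpochS.
have := q1B (ltn0Sn k); rewrite !exprS => h1.
by field; nz.
Qed.

(* Multiplying by [(1 - xA)(1 - xB)] is triangular on the basis [(A,B;q)_k],
   with coefficients depending on [A] and [B] only through [A * B]. *)
Lemma qpoch_basis_expansion A B (x : nat -> F) (c : nat -> nat -> F) :
  c 0%N 0%N = 1 -> (forall n k, (n < k)%N -> c n k = 0) ->
  (forall n, c n.+1 0%N = (1 - x n) * (1 - x n * (A * B)) * c n 0%N) ->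
  (forall n k, (k <= n)%N -> c n.+1 k.+1 = x n / q ^+ k * c n k
     + (1 - x n / q ^+ k.+1) * (1 - x n * q ^+ k.+1 * (A * B)) * c n k.+1) ->
  forall n, \prod_(i < n) ((1 - x i * A) * (1 - x i * B))
     = \sum_(k < n.+1) c n k * (P A k * P B k).
Proof.
move=> c00 cgt cS0 cSS; elim=> [|n IH].
  by rewrite big_ord0 big_ord_recl big_ord0 !qpoch0 c00; ring.
rewrite big_ord_recr IH /= [RHS]big_ord_recl /= cS0 !qpoch0.
(* With u = q^k, (1 - xA)(1 - xB) = (x/u)(1 - uA)(1 - uB) + (1 - x/u)(1 - xuAB); the first summand
   raises k by one. *)
transitivity (\sum_(k < n.+1) (x n / q ^+ k * c n k * (P A k.+1 * P B k.+1)
   + (1 - x n / q ^+ k) * (1 - x n * q ^+ k * (A * B)) * c n k * (P A k * P B k))).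
  rewrite mulr_suml; apply: eq_bigr => k _; rewrite !qpochS.
  by field; nz.
rewrite big_split /= [X in _ + X]big_ord_recl /= !qpoch0 expr0 divr1 !mulr1.
rewrite addrCA; congr (_ + _).
(* The second sum is shifted by one; the term k = n that this adds vanishes because [c n n.+1] is
   0. *)
transitivity (\sum_(k < n.+1) (x n / q ^+ k * c n k * (P A k.+1 * P B k.+1)
   + (1 - x n / q ^+ k.+1) * (1 - x n * q ^+ k.+1 * (A * B)) * c n k.+1
        * (P A k.+1 * P B k.+1))).
  rewrite big_split /=; congr (_ + _); rewrite [RHS]big_ord_recr /=.
  by rewrite cgt // mulr0 mul0r addr0; apply: eq_bigr.
apply: eq_bigr => k _; rewrite /bump /= add1n cSS; last by rewrite -ltnS.
by rewrite [RHS]mulrDl.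
Qed.

(** The choice x_i = y q^i in the expansion above. This is the q-Pfaff-Saalschütz sum cleared of
    denominators, so that y, A and B are arbitrary. *)
Lemma qSaalschutz y A B n :
  P (y * A) n * P (y * B) n = \sum_(k < n.+1) gbinom n k * y ^+ k
     * P y (n - k) * P (y * (A * B) * q ^+ k) (n - k) * (P A k * P B k).
Proof.
pose c n k : F := gbinom n k * y ^+ k * P y (n - k) * P (y * (A * B) * q ^+ k) (n - k).
rewrite -(@qpoch_basis_expansion A B (fun i => y * q ^+ i) c) /c.
- by rewrite -big_split /=; apply: eq_bigr => i _; rewrite -!mulrA ![q ^+ _ * _]mulrC.
- by rewrite gbinom0 !qpoch0; ring.
- by move=> {}n k h; rewrite gbinom_gt // !mul0r.
- by move=> {}n; rewrite !gbinom0 !subn0 !qpochS; ring.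
move=> {}n k; rewrite leq_eqVlt => /predU1P[->|h].
  rewrite (@gbinom_gt n n.+1) // !gbinomn !subnn !qpoch0 exprS; field; nz.
rewrite subSS (_ : n - k = (n - k.+1).+1)%N; last by lia.
rewrite [P y _.+1]qpochS [P (_ * q ^+ k.+1) _.+1]qpochS [P (_ * q ^+ k) _.+1]qpochSl.
rewrite -[_ * q ^+ k * q]mulrA -exprSr.
set M := P (y * _ * q ^+ k.+1) _.
set L := P y _.
have e : q ^+ n = q ^+ (n - k.+1) * q * q ^+ k by rewrite -!exprSr -exprD; congr (_ ^+ _); lia.
have h1 := q1B (ltn0Sn k); have h2 := q1B (ltn0Sn n).
(* Both Gaussian binomials are expressed through the one at (n+1, k+1), which leaves a rational
   identity in q^k and q^(n-k-1). *)
have -> : gbinom n k = (1 - q ^+ k.+1) / (1 - q ^+ n.+1) * gbinom n.+1 k.+1.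
  by rewrite mulrAC gbinomSk mulrAC mulfV // mul1r.
have -> : gbinom n k.+1 = (1 - q ^+ n.+1 / q ^+ k.+1) / (1 - q ^+ n.+1) * gbinom n.+1 k.+1.
  by rewrite mulrAC gbinomSn mulrAC mulfV // mul1r.
move: h2; rewrite !exprS e => h2; move: (gbinom _ _) => G.
move: (q ^+ (n - k.+1)) (qX (n - k.+1)) (q ^+ k) (qX k) h2 => u u0 v v0 h2.
by field; nz.
Qed.

(** * Andrews' terminating q-Watson sum *)

Let qM2 k : q ^+ (2 * k) = (q ^+ k) ^+ 2. Proof. by rewrite mulnC exprM. Qed.
Let q2E k : (q ^+ 2) ^+ k = (q ^+ k) ^+ 2. Proof. by rewrite exprAC. Qed.
Let q2X k : (q ^+ 2) ^+ k != 0. Proof. by rewrite !expf_neq0. Qed.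
Let q2q0 n : P2 (q ^+ 2) n != 0.
Proof.
by rewrite qpoch_neq0; apply/forallP => k; rewrite -exprS -exprM q1B.
Qed.

(** The coefficient of (A, B; q)_k in (qA, qB; q^2)_n, where x = A B. *)
Definition watson_coef x n k : F := if (k <= n)%N then
  q ^+ 'C(k.+1, 2) * P2 (q ^+ (2 * k).+1 * x) (n - k) * P q (2 * n - k)
  / (P2 (q ^+ 2) (n - k) * P q k) else 0.

(** The choice x_i = q^(2i+1), which puts base q^2 on the left and base q in the expansion. *)
Lemma qWatson_expansion A B n :
  P2 (q * A) n * P2 (q * B) n
  = \sum_(k < n.+1) watson_coef (A * B) n k * (P A k * P B k).
Proof.
rewrite -(@qpoch_basis_expansion A B (fun i => q ^+ (2 * i).+1)).
- rewrite -big_split /=; apply: eq_bigr => i _.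
  by rewrite -!exprM exprS; congr ((1 - _) * (1 - _)); ring.
- by rewrite /watson_coef /= !qpoch0 bin_small //; field; nz.
- by move=> {}n k h; rewrite /watson_coef leqNgt h.
- move=> {}n; rewrite /watson_coef /= !subn0 mulnS !qpochS bin_small //.
  have := q1B (ltn0Sn (2 * n).+1).
  rewrite !q2E !(exprS q (2 * n).+1) !(exprS q (2 * n)) !qM2 muln0 expr0 expr1 => h1.
  field; nz.
  by rewrite (_ : _ ^+ 2 = q * (q * q ^+ n ^+ 2)) //; ring.
move=> {}n k; rewrite leq_eqVlt => /predU1P[->|h].
  rewrite /watson_coef leqnn ltnn leqnn !subnn !qpoch0.
  have [-> ->] : (2 * n.+1 - n.+1 = n.+1 /\ 2 * n - n = n)%N by lia.
  rewrite (binS n.+1 1) bin1 exprD !exprS qM2.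
  by field; nz.
(* For k < n, writing n = k + r + 1 turns every power of q into a product of powers of q, q^k and
   q^r, up to a common binomial power. *)
have [r ->] : exists r, n = (k + r.+1)%N.
  by exists (n - k.+1)%N; rewrite addnS -addSn subnKC.
have [c1 c2 c3] : [/\ k < (k + r.+1).+1, k < k + r.+1 & k <= k + r.+1]%N by split; lia.
rewrite /watson_coef c1 c2 c3.
have [-> ->] : ((k + r.+1).+1 - k.+1 = r.+1 /\ k + r.+1 - k.+1 = r)%N by lia.
have -> : (k + r.+1 - k = r.+1)%N by lia.
have [-> ->] : (2 * (k + r.+1).+1 - k.+1 = (k + 2 * r).+3 /\
  2 * (k + r.+1) - k.+1 = (k + 2 * r).+1)%N by lia.
have -> : (2 * (k + r.+1) - k = (k + 2 * r).+2)%N by lia.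
rewrite (qpochSl (q ^+ (2 * k).+1 * _)) (qpochS (q ^+ (2 * k.+1).+1 * _)).
have -> : q ^+ (2 * k).+1 * (A * B) * q ^+ 2 = q ^+ (2 * k.+1).+1 * (A * B).
  by rewrite mulnS !exprS; ring.
rewrite !qpochS !q2E (binS k.+1 1) bin1 exprD.
move: (P2 _ _) (P2 (q ^+ 2) _) (q2q0 r) => V U U0.
move: (P q _) (P q k) (qq0 k) => M L L0.
have := q1B (ltn0Sn (2 * r).+1); have := q1B (ltn0Sn k).
have e1 s : q ^+ s.+1 = q * q ^+ s by rewrite exprS.
have -> : q ^+ (k + 2 * r).+2 = q * q * q ^+ k * (q ^+ r) ^+ 2.
  by rewrite !e1 exprD qM2; ring.
have -> : q ^+ (k + 2 * r).+1 = q * q ^+ k * (q ^+ r) ^+ 2.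
  by rewrite !e1 exprD qM2; ring.
have -> : q ^+ (k + 2 * r) = q ^+ k * (q ^+ r) ^+ 2 by rewrite exprD qM2.
have -> : q ^+ (2 * k.+1).+1 = q * q * q * (q ^+ k) ^+ 2.
  by rewrite mulnS !e1 qM2; ring.
have -> : q ^+ (2 * k).+1 = q * (q ^+ k) ^+ 2 by rewrite !e1 qM2.
have -> : q ^+ (2 * (k + r.+1)).+1 = q * q * q * (q ^+ k) ^+ 2 * (q ^+ r) ^+ 2.
  by rewrite mulnDr mulnS !e1 exprD !e1 !qM2; ring.
have -> : q ^+ (2 * r).+2 = q ^+ 2 * (q ^+ r) ^+ 2 by rewrite !e1 qM2; ring.
rewrite (e1 k); move: (q ^+ k) (qX k) (q ^+ r) (qX r) (q ^+ 'C(_, _)) => u u0 v v0 w h1 h2.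
by field; nz; rewrite exprMn.
Qed.

Lemma qpoch_even n : P q (2 * n) = P2 q n * P2 (q ^+ 2) n.
Proof.
elim: n => [|n IH]; first by rewrite muln0 !qpoch0 mulr1.
by rewrite mulnS !qpochS IH !q2E (exprS q (2 * n)) qM2; ring.
Qed.

Lemma P2q0 n : P2 q n != 0.
Proof.
by have := qq0 (2 * n); rewrite qpoch_even mulf_eq0 negb_or => /andP[].
Qed.

(** [qWatson_expansion] divided by (q, qAB; q^2)_n. Base q^2 merges parameter pairs: (q^(-2n);
    q^2)_k is (q^(-n), -q^(-n); q)_k, and (qAB; q^2)_k stands for the two square roots of qAB, which
    need not lie in [F]. *)
Lemma qWatson A B n : P2 (q * (A * B)) n != 0 ->
  P2 (q * A) n * P2 (q * B) n / (P2 q n * P2 (q * (A * B)) n)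
  = \sum_(k < n.+1) P2 (q ^+ (2 * n))^-1 k
     / (P q k * P2 (q * (A * B)) k * P (q ^+ (2 * n))^-1 k) * q ^+ k * (P A k * P B k).
Proof.
move=> h; rewrite qWatson_expansion mulr_suml; apply: eq_bigr => -[k /=]; rewrite ltnS => le_kn _.
rewrite mulrAC; congr (_ * _).
rewrite /watson_coef le_kn; move: (h); rewrite (qpochB _ _ le_kn) mulf_eq0 negb_or => /andP[h1 h2].
have -> : q ^+ (2 * k).+1 * (A * B) = q * (A * B) * (q ^+ 2) ^+ k.
  by rewrite exprS -exprM; ring.
have le2 : (k <= 2 * n)%N by lia.
have e1 : P2 (q ^+ (2 * n))^-1 k = (-1) ^+ k * (q ^+ 'C(k, 2)) ^+ 2
     / (q ^+ (n * k)) ^+ 2 * P2 (q ^+ 2) n / P2 (q ^+ 2) (n - k).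
  by rewrite -!q2E -(qpoch_neg (expf_neq0 2 q0) le_kn) mulfK // exprM.
have e2 : P (q ^+ (2 * n))^-1 k = (-1) ^+ k * q ^+ 'C(k, 2)
     / (q ^+ (n * k)) ^+ 2 * (P2 q n * P2 (q ^+ 2) n) / P q (2 * n - k).
  by rewrite -qM2 mulnA -qpoch_even -(qpoch_neg q0 le2) mulfK.
rewrite e1 e2 (binS k 1) bin1 exprD; have := P2q0 n; have := signr_eq0 F k.
move=> /negbT s0 n0; field; nz.
Qed.

(* The terminating 6phi5 sum in base [A], multiplied by [(q A / b, q A / d; q)_k]
   so that [b] and [d] produce no denominators; [G] is its WZ mate. *)
Lemma qsix_phi_five A b d k : b != 0 -> d != 0 ->
  (forall s, (s <= 2 * k)%N -> 1 - A * q ^+ s != 0) ->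
  \sum_(j < k.+1) (-1) ^+ j * q ^+ 'C(j.+1, 2) * gbinom k j
     * (1 - A * q ^+ (2 * j)) / P (A * q ^+ j) k.+1 * (P b j * P d j)
     * (P (q ^+ j.+1 * (A / b)) (k - j) * P (q ^+ j.+1 * (A / d)) (k - j))
     * (A / (b * d)) ^+ j
  = P (q * (A / (b * d))) k.
Proof.
move=> b0 d0.
pose t k j : F := (-1) ^+ j * q ^+ 'C(j.+1, 2) * gbinom k j
     * (1 - A * q ^+ (2 * j)) / P (A * q ^+ j) k.+1 * (P b j * P d j)
     * (P (q ^+ j.+1 * (A / b)) (k - j) * P (q ^+ j.+1 * (A / d)) (k - j))
     * (A / (b * d)) ^+ j.
pose G k j : F := - (-1) ^+ j * q ^+ 'C(j, 2) * q ^+ k.+1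
     * ((1 - q ^+ j) / (1 - q ^+ k.+1) * gbinom k.+1 j) / P (A * q ^+ j) k.+1
     * (P b j * P d j) * (P (q ^+ j * (A / b)) (k.+1 - j)
     * P (q ^+ j * (A / d)) (k.+1 - j)) * (A / (b * d)) ^+ j.
rewrite -/(t k) => hA.
have tgt n j : (n < j)%N -> t n j = 0.
  by move=> h; rewrite /t gbinom_gt // !(mulr0, mul0r).
elim: k hA => [|k IH] hA.
  rewrite big_ord1 /t gbinom0 !qpochS !qpoch0 bin_small //.
  have := hA 0%N isT; rewrite !expr0 !mulr1 => h; field; nz.
have {}IH : \sum_(j < k.+1) t k j = P (q * (A / (b * d))) k.
  by apply: IH => s hs; apply: hA; lia.
have hP j n : (j + n <= (2 * k.+1).+1)%N -> P (A * q ^+ j) n != 0.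
  move=> hjn; rewrite qpoch_neq0; apply/forallP => -[s hs] /=.
  by rewrite -mulrA -exprD hA //; lia.
have k1 := q1B (ltn0Sn k).
(* G vanishes at j = 0 and j = k + 2, so its differences sum to zero. *)
have G0 : G k 0%N = 0 by rewrite /G expr0 subrr !(mul0r, mulr0).
have GS : G k k.+2 = 0 by rewrite /G gbinom_gt // !(mul0r, mulr0).
(* The WZ relation: t(k+1, j) is t(k, j) times the growth factor 1 - q^(k+1) A/(b d) of the
   right-hand side, plus a difference of G in j. *)
have rec j : (j <= k.+1)%N ->
    t k.+1 j = (1 - q * (A / (b * d)) * q ^+ k) * t k j + (G k j.+1 - G k j).
  rewrite leq_eqVlt => /predU1P[->|].
    rewrite (tgt k) // GS /G /t !subnn !qpoch0 gbinomn (qpochS _ _ k.+1).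
    have := hP k.+1 k.+2; rewrite qpochS => /(_ ltac:(lia)).
    rewrite mulf_eq0 negb_or => /andP[h1 h2].
    rewrite (binS k.+1) bin1 exprD qM2; move: h2 h1 k1.
    move: (P (A * q ^+ k.+1) k.+1) (P b _) (P d _) ((A / _) ^+ _) (q ^+ k.+1) => u v w z x h2 h1 h3.
    by field; nz; rewrite expr2 mulrA.
  rewrite ltnS => lejk.
  have gk : gbinom k j = (1 - q ^+ k.+1 / q ^+ j) / (1 - q ^+ k.+1) * gbinom k.+1 j.
    by rewrite mulrAC gbinomSn mulrAC mulfV // mul1r.
  have gj : (1 - q ^+ j.+1) / (1 - q ^+ k.+1) * gbinom k.+1 j.+1 = gbinom k j.
    by rewrite mulrAC gbinomSk mulrAC mulfV // mul1r.
  rewrite /t /G gj {}gk subSS subSn //.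
  have ek : q ^+ k = q ^+ (k - j) * q ^+ j by rewrite -exprD subnK.
  have ex x : q ^+ j * (A / x) * q = q ^+ j.+1 * (A / x) by rewrite exprSr; ring.
  have eA : A * q ^+ j * q = A * q ^+ j.+1 by rewrite exprSr; ring.
  rewrite !(qpochS (q ^+ j.+1 * _)) !(qpochSl (q ^+ j * _)) !ex.
  have := hP j k.+2 ltac:(lia); rewrite qpochS qpochSl eA.
  rewrite (qpochS (A * q ^+ j.+1)) (qpochS b) (qpochS d) (binS j 1) bin1 exprD qM2.
  rewrite !mulf_eq0 !negb_or => /andP[/andP[h1 h2] h3].
  move: h1 h2 h3 k1.
  move: (P (A * q ^+ j.+1) k) => u h1 h2 h3.
  rewrite !(exprS q j) !(exprS q k) !(exprS _ j) ek in h3 *.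
  move: (P (_ * (A / b)) _) (P (_ * (A / d)) _) (P b j) (P d j) ((A / (b * d)) ^+ j) => Pb Pd v w z k2.
  move: (q ^+ j) (qX j) (q ^+ (k - j)) (q ^+ 'C(j, 2)) (gbinom _ _) h1 h2 h3 k2.
  move=> x x0 y e g h1 h2 h3 k2.
  have h4 : 1 - A * (q * x) * (y * x) != 0 by rewrite (_ : _ * _ * _ = A * x * (q * (y * x))) //; ring.
  by field; nz.
rewrite -[LHS]/(\sum_(j < k.+2) t k.+1 j).
transitivity (\sum_(j < k.+2) ((1 - q * (A / (b * d)) * q ^+ k) * t k j
  + (G k j.+1 - G k j))).
  by apply: eq_bigr => -[j /= hj] _; rewrite rec.
rewrite big_split /= -mulr_sumr big_ord_recr /= IH tgt // addr0 qpochS.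
rewrite -(big_mkord xpredT (fun j => G k j.+1 - G k j)) telescope_sumr // GS G0.
by rewrite subr0 addr0 mulrC.
Qed.

(** * Sears' transformation *)

Lemma bin2D k r : 'C(k + r, 2) = ('C(k, 2) + 'C(r, 2) + k * r)%N.
Proof.
elim: k => [|k IH]; first by rewrite bin0n mul0n addn0 !add0n.
by rewrite addSn !(binS _ 1) !bin1 IH; lia.
Qed.

Lemma mulnn_bin2 k : (k * k = 'C(k, 2) + 'C(k, 2) + k)%N.
Proof. by elim: k => [|k IH]; rewrite ?bin0n // binS bin1; lia. Qed.

(** The balance condition on e f lets (e/(xy); q)_(p-s) and (e/y; q)_p in [qSaalschutz] be reversed
    into factors in f. The products (e q^s, f q^s; q)_(p-s) stand in for denominators (e, f;
    q)_s. *)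
Lemma qSaalschutz_sum p x y e f : x != 0 -> y != 0 -> f != 0 ->
  e * f * q ^+ p = q * x * y ->
  \sum_(s < p.+1) (-1) ^+ s * q ^+ 'C(s.+1, 2) / q ^+ (p * s) * gbinom p s
     * (P x s * P y s) * (P (e * q ^+ s) (p - s) * P (f * q ^+ s) (p - s))
  = x ^+ p * (P (e / x) p * P (f / x) p).
Proof.
move=> x0 y0 f0 H.
have eE : e = q * x * y / (f * q ^+ p) by rewrite -H; field; nz.
have := qSaalschutz (e / (x * y)) x y p.
have -> : e / (x * y) * x = e / y by field; nz.
have -> : e / (x * y) * y = e / x by field; nz.
have -> : e / (x * y) * (x * y) = e by field; nz.
have -> : e / (x * y) = q / (q ^+ p * f) by rewrite eE; field; nz.
have -> : e / y = q / (q ^+ p * (f / x)) by rewrite eE; field; nz.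
rewrite qpoch_rev ?mulf_neq0 ?invr_eq0 // => E.
transitivity ((- f) ^+ p * q ^+ 'C(p, 2) * ((- 1 / (f / x)) ^+ p / q ^+ 'C(p, 2)
  * P (f / x) p * P (e / x) p)); last first.
  have -> : - 1 / (f / x) = x / (- f) by field; nz.
  by rewrite expr_div_n; field; nz.
rewrite {}E mulr_sumr; apply: eq_bigr => -[k /=]; rewrite ltnS => le_kp _.
have [r ->] : exists r, p = (k + r)%N by exists (p - k)%N; rewrite subnKC.
rewrite addKn (_ : q / (q ^+ (k + r) * f) = q / (q ^+ r * (f * q ^+ k))); last first.
  by rewrite exprD; field; nz.
rewrite qpoch_rev ?mulf_neq0 // bin2D (binS k) bin1 mulnDl mulnn_bin2 !exprD.
have -> : - 1 / (f * q ^+ k) = ((- f) * q ^+ k)^-1 by field; nz.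
rewrite exprVn expr_div_n !exprMn -!exprM (mulnC r).
rewrite mulnn_bin2 !exprD (exprNn f k).
by field; nz.
Qed.

Lemma sum_triangle n (h : nat -> nat -> F) :
  \sum_(k < n.+1) \sum_(j < k.+1) h k j
  = \sum_(j < n.+1) \sum_(s < (n - j).+1) h (j + s)%N j.
Proof.
elim: n => [|n IH]; first by rewrite !big_ord1.
rewrite big_ord_recr IH /= [X in _ + X]big_ord_recr [RHS]big_ord_recr /= addrA.
rewrite subnn big_ord1 addn0; congr (_ + _); rewrite -big_split /=.
apply: eq_bigr => -[j /=]; rewrite ltnS => h1 _.
by rewrite subSn // [RHS]big_ord_recr /= -subSn // subnKC // leqW.
Qed.

Lemma qpoch_neg_gbinom n k : (k <= n)%N ->
  P (q ^+ n)^-1 k / P q k = (-1) ^+ k * q ^+ 'C(k, 2) / q ^+ (n * k) * gbinom n k.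
Proof.
move=> h; rewrite /gbinom h.
have -> : P (q ^+ n)^-1 k = (-1) ^+ k * q ^+ 'C(k, 2) / q ^+ (n * k) * P q n / P q (n - k).
  by rewrite -(qpoch_neg q0 h) mulfK.
by field; nz.
Qed.

Lemma gbinomM n k j : (j <= k)%N -> (k <= n)%N ->
  gbinom n k * gbinom k j = gbinom n j * gbinom (n - j) (k - j).
Proof.
move=> jk kn; rewrite /gbinom kn jk (leq_trans jk kn) leq_sub2r //.
rewrite (_ : n - j - (k - j) = n - k)%N; last by lia.
by field; nz.
Qed.

(** By q-Saalschütz, (b, c; q)_k / (d; q)_k expands in the products (d/b, d/c; q)_j. After
    interchanging the sums the inner one is again a q-Saalschütz sum, balanced by d e f q^n = q a b
    c. *)
Lemma qSears n a b c d e f :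
  a != 0 -> b != 0 -> c != 0 -> d != 0 -> e != 0 -> f != 0 ->
  d * e * f * q ^+ n = q * a * b * c ->
  P d n != 0 -> P e n != 0 -> P f n != 0 ->
  P (q / (q ^+ n * (e / a))) n != 0 -> P (q / (q ^+ n * (f / a))) n != 0 ->
  \sum_(k < n.+1) P (q ^+ n)^-1 k * P a k * P b k * P c k
      / (P q k * P d k * P e k * P f k) * q ^+ k
  = a ^+ n * P (e / a) n * P (f / a) n / (P e n * P f n)
    * \sum_(j < n.+1) P (q ^+ n)^-1 j * P a j * P (d / b) j * P (d / c) j
      / (P q j * P d j * P (q / (q ^+ n * (e / a))) j
         * P (q / (q ^+ n * (f / a))) j) * q ^+ j.
Proof.
move=> a0 b0 c0 d0 e0 f0 H Pd0 Pe0 Pf0 Pea0 Pfa0.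
(* This y makes y (d/b), y (d/c) and y (d/b)(d/c) equal to c, b and d. *)
pose y := b * c / d.
have y0 : y != 0 by rewrite /y; nz.
transitivity (\sum_(k < n.+1) \sum_(j < k.+1)
  (-1) ^+ k * q ^+ 'C(k.+1, 2) / q ^+ (n * k) * gbinom n k * P a k / (P e k * P f k)
   * (gbinom k j * y ^+ j * P y (k - j) / P d j * (P (d / b) j * P (d / c) j))).
  apply: eq_bigr => -[k /=]; rewrite ltnS => kn _.
  rewrite -mulr_sumr.
  have -> : \sum_(j < k.+1) gbinom k j * y ^+ j * P y (k - j) / P d j * (P (d / b) j * P (d / c) j)
    = P b k * P c k / P d k.
    have := qSaalschutz y (d / b) (d / c) k.
    have -> : y * (d / b) = c by rewrite /y; field; nz.
    have -> : y * (d / c) = b by rewrite /y; field; nz.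
    have -> : y * (d / b * (d / c)) = d by rewrite /y; field; nz.
    rewrite [P b k * _]mulrC => ->; rewrite mulr_suml; apply: eq_bigr => -[j /=].
    rewrite ltnS => jk _.
    have := qpoch_neq0W kn Pd0; rewrite (qpochB _ _ jk) mulf_eq0 negb_or => /andP[h1 h2].
    by field; nz.
  have := qpoch_neq0W kn Pd0; have := qpoch_neq0W kn Pe0; have := qpoch_neq0W kn Pf0.
  move=> h1 h2 h3; have E := qpoch_neg_gbinom kn.
  rewrite (binS k) bin1 exprD.
  have -> : P (q ^+ n)^-1 k = (-1) ^+ k * q ^+ 'C(k, 2) / q ^+ (n * k) * gbinom n k * P q k.
    by rewrite -E mulfVK.
  by field; nz.
rewrite (@sum_triangle n (fun k j => (-1) ^+ k * q ^+ 'C(k.+1, 2) / q ^+ (n * k)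
   * gbinom n k * P a k / (P e k * P f k)
   * (gbinom k j * y ^+ j * P y (k - j) / P d j * (P (d / b) j * P (d / c) j)))).
rewrite mulr_sumr; apply: eq_bigr => -[j /=]; rewrite ltnS => jn _.
set p := (n - j)%N.
(* The balance condition for the inner sum of length p, with parameters a q^j, y, e q^j and f
   q^j. *)
have Hj : e * q ^+ j * (f * q ^+ j) * q ^+ p = q * (a * q ^+ j) * y.
  have -> : q * (a * q ^+ j) * y = q ^+ j * (q * a * b * c) / d by rewrite /y; field; nz.
  by rewrite -H -(subnKC jn) exprD -/p; field; nz.
have S := @qSaalschutz_sum p (a * q ^+ j) y (e * q ^+ j) (f * q ^+ j)
   ltac:(nz) y0 ltac:(nz) Hj.
have Pdj := qpoch_neq0W jn Pd0.
have np : n = (j + p)%N by rewrite subnKC.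
(* K collects the factors free of the inner index s. *)
pose K := (-1) ^+ j * q ^+ 'C(j.+1, 2) / q ^+ (n * j) * gbinom n j * P a j
  * y ^+ j / P d j * (P (d / b) j * P (d / c) j) / (P e n * P f n).
transitivity (K * ((a * q ^+ j) ^+ p * (P (e / a) p * P (f / a) p))).
  have ea : e * q ^+ j / (a * q ^+ j) = e / a by field; nz.
  have fa : f * q ^+ j / (a * q ^+ j) = f / a by field; nz.
  rewrite -{1}ea -{1}fa -S mulr_sumr; apply: eq_bigr => -[s /=]; rewrite ltnS => sp _.
  have jsn : (j + s <= n)%N by rewrite np leq_add2l.
  have js : (j <= j + s)%N by exact: leq_addr.
  have := gbinomM js jsn; rewrite addKn -/p => Eg.
  have ns : (n - (j + s) = p - s)%N by rewrite subnDA.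
  move: Pe0 Pf0; rewrite /K (qpochB e q jsn) (qpochB f q jsn) !mulf_eq0 !negb_or.
  rewrite ns => /andP[e1 e2] /andP[f1 f2].
  have c1 : q ^+ 'C((j + s).+1, 2) = q ^+ 'C(j, 2) * q ^+ 'C(s, 2) * q ^+ (j * s) * (q ^+ j * q ^+ s).
    by rewrite -!exprD; congr (_ ^+ _); rewrite binS bin1 bin2D.
  have c2 : q ^+ (n * (j + s)) = q ^+ (n * j) * (q ^+ (j * s) * q ^+ (p * s)).
    by rewrite -!exprD; congr (_ ^+ _); rewrite mulnDr -mulnDl -np.
  rewrite c1 c2 (binS s) (binS j) !bin1 !exprD qpochD.
  have -> : e * q ^+ j * q ^+ s = e * (q ^+ j * q ^+ s) by rewrite mulrA.
  have -> : f * q ^+ j * q ^+ s = f * (q ^+ j * q ^+ s) by rewrite mulrA.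
  rewrite exprD in e2 f2.
  transitivity ((-1) ^+ j * (-1) ^+ s * q ^+ 'C(j, 2) * q ^+ 'C(s, 2) * (q ^+ j * q ^+ s)
    / (q ^+ (n * j) * q ^+ (p * s)) * (gbinom n j * gbinom p s) * (P a j * P (a * q ^+ j) s)
    * (y ^+ j * P y s / P d j * (P (d / b) j * P (d / c) j)) / (P e (j + s) * P f (j + s))).
    rewrite -Eg; field; nz.
  by field; nz.
rewrite /K.
have -> : P (q ^+ n)^-1 j = (-1) ^+ j * q ^+ 'C(j, 2) / q ^+ (n * j) * gbinom n j * P q j.
  by rewrite -(qpoch_neg_gbinom jn) mulfVK.
(* The new lower parameter q^(1-n)/x reverses x, so dividing (x; q)_n by its first j factors leaves
   (x; q)_(n-j) up to a monomial. *)
have ratio x : x != 0 -> P (q / (q ^+ n * x)) n != 0 ->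
    P x n / P (q / (q ^+ n * x)) j = P x p * (- (x * q ^+ p)) ^+ j * q ^+ 'C(j, 2).
  move=> x0 /(qpoch_neq0W jn).
  have -> : q / (q ^+ n * x) = q / (q ^+ j * (x * q ^+ p)).
    by rewrite np exprD; field; nz.
  have xp0 : x * q ^+ p != 0 by nz.
  rewrite (qpoch_rev _ xp0 q0) => h.
  rewrite np addnC qpochD; move: h; rewrite !mulf_eq0 !negb_or => /andP[_ h].
  have -> : - 1 / (x * q ^+ p) = (- (x * q ^+ p))^-1 by field; nz.
  by rewrite exprVn; field; nz.
have ea0 : e / a != 0 by nz.
have fa0 : f / a != 0 by nz.
have Re := ratio _ ea0 Pea0; have Rf := ratio _ fa0 Pfa0.
have Peaj := qpoch_neq0W jn Pea0; have Pfaj := qpoch_neq0W jn Pfa0.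
transitivity (a ^+ n / (P e n * P f n)
  * (((-1) ^+ j * q ^+ 'C(j, 2) / q ^+ (n * j) * gbinom n j) * P a j
     * P (d / b) j * P (d / c) j / P d j * q ^+ j)
  * (P (e / a) n / P (q / (q ^+ n * (e / a))) j) * (P (f / a) n / P (q / (q ^+ n * (f / a))) j)); last first.
  by field; nz.
rewrite Re Rf.
(* The balance condition rewrites y so that b, c and d disappear from y^j. *)
have -> : y = e * f * q ^+ n / (q * a).
  have -> : y = (q * a * b * c) / (q * a * d) by rewrite /y; field; nz.
  by rewrite -H; field; nz.
have -> : q ^+ n = q ^+ j * q ^+ p by rewrite -exprD -np.
have -> : a ^+ n = a ^+ j * a ^+ p by rewrite -exprD -np.
have -> : q ^+ 'C(j.+1, 2) = q ^+ 'C(j, 2) * q ^+ j by rewrite binS bin1 exprD.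
have -> : (a * q ^+ j) ^+ p = a ^+ p * q ^+ (j * p) by rewrite exprMn exprM.
have -> : (e * f * (q ^+ j * q ^+ p) / (q * a)) ^+ j
  = (e * f) ^+ j * (q ^+ 'C(j, 2) * q ^+ 'C(j, 2) * q ^+ (j * p)) / a ^+ j.
  have e1 : (q ^+ j) ^+ j = q ^+ 'C(j, 2) * q ^+ 'C(j, 2) * q ^+ j.
    by rewrite -exprM {1}mulnn_bin2 !exprD.
  have e2 : (q ^+ p) ^+ j = q ^+ (j * p) by rewrite mulnC exprM.
  by rewrite expr_div_n !exprMn e1 e2; field; nz.
have -> : (- (e / a * q ^+ p)) ^+ j = (-1) ^+ j * (e ^+ j / a ^+ j * q ^+ (j * p)).
  by rewrite -[- _]mulN1r !exprMn exprVn (mulnC j) exprM.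
have -> : (- (f / a * q ^+ p)) ^+ j = (-1) ^+ j * (f ^+ j / a ^+ j * q ^+ (j * p)).
  by rewrite -[- _]mulN1r !exprMn exprVn (mulnC j) exprM.
have s2 : (-1) ^+ j * (-1) ^+ j = 1 :> F by rewrite -exprMn mulrNN mulr1 expr1n.
rewrite exprMn.
(* The right-hand side carries (-1)^j three times; inserting its square, which is 1, on the left
   lets [field] treat it as a variable. *)
transitivity (((-1) ^+ j * (-1) ^+ j) * ((-1) ^+ j * (q ^+ 'C(j, 2) * q ^+ j)
 / q ^+ (n * j) * gbinom n j * P a j *
 ((e ^+ j * f ^+ j) * (q ^+ 'C(j, 2) * q ^+ 'C(j, 2) * q ^+ (j * p)) / a ^+ j)
  / P d j * (P (d / b) j * P (d / c) j) / (P e n * P f n)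
  * (a ^+ p * q ^+ (j * p) * (P (e / a) p * P (f / a) p)))).
  by rewrite s2 mul1r.
move: ((-1) ^+ j) => sg; field; nz.
Qed.

(** * The q-Watson sum iterated over j *)

Lemma qXV_neq1 M i : (i < M)%N -> 1 - q ^+ i / q ^+ M != 0.
Proof.
move=> iM; have -> : 1 - q ^+ i / q ^+ M = - (1 - q ^+ (M - i)) / q ^+ (M - i).
  have -> : q ^+ M = q ^+ i * q ^+ (M - i) by rewrite -exprD subnKC // ltnW.
  by field; nz.
have := q1B (_ : 0 < M - i)%N; rewrite subn_gt0 => /(_ iM) h; nz.
Qed.

Lemma qpochV_neq0 M k : (k <= M)%N -> P (q ^+ M)^-1 k != 0.
Proof.
move=> kM; rewrite qpoch_neq0; apply/forallP => -[i ik] /=.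
by rewrite mulrC qXV_neq1 // (leq_trans ik kM).
Qed.

(** The terminating 6phi5 sum with A = q^(-2(m+n)-1), b = q^(-m) and d = q^(-m-n), for which q A/(b
    d) = q^(-n). The last factor of the summand is the coefficient of index k - j in [qWatson] at m
    + n - j. *)
Lemma qWatson_connection m n k : (k <= m + n)%N ->
  let y := (q ^+ (m + n))^-1 in
  let w := (q ^+ (m + n + n))^-1 in
  \sum_(j < k.+1) (-1) ^+ j * q ^+ 'C(j.+1, 2) / q ^+ (n * j)
     * (P (q ^+ m)^-1 j * P y j * P (- y) j)
     / (P q j * P w j * P (q ^+ j / q ^+ (2 * (m + n)).+1) j)
     * (P2 (q ^+ (2 * (m + n - j)))^-1 (k - j)
        / (P q (k - j) * P (q ^+ (2 * (m + n - j)))^-1 (k - j)) * q ^+ (k - j))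
  = P (q ^+ n)^-1 k * P (- y) k / (P q k * P w k) * q ^+ k.
Proof.
set N := (m + n)%N => kN y w.
have y0 : y != 0 by rewrite /y; nz.
pose A := (q ^+ (2 * N).+1)^-1.
have Ay : A = y ^+ 2 / q by rewrite /A /y exprS qM2; field; nz.
(* Since k <= N, the exponent s stays below 2N + 1 and no factor 1 - A q^s vanishes. *)
have hA s : (s <= 2 * k)%N -> 1 - A * q ^+ s != 0.
  by move=> hs; rewrite mulrC qXV_neq1 // ltnS (leq_trans hs) // leq_mul2l kN orbT.
have := @qsix_phi_five A (q ^+ m)^-1 y k ltac:(nz) y0 hA.
have -> : A / ((q ^+ m)^-1 * y) = (q ^+ n * q)^-1.
  by rewrite Ay /y /N exprD; field; nz.
have -> : q / (q ^+ n * q) = (q ^+ n)^-1 by field; nz.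
have wk : P w k != 0 by apply: qpochV_neq0; lia.
move=> <-; rewrite -[RHS]mulrA -[RHS]mulrA mulr_suml.
apply: eq_bigr => -[j /=]; rewrite ltnS => jk _.
have jN := leq_trans jk kN.
have -> : (q ^+ (2 * (N - j)))^-1 = y ^+ 2 * (q ^+ j) ^+ 2.
  rewrite /y -(subnK jN) qM2 !exprD subnK //; field; nz.
have -> : y ^+ 2 * (q ^+ j) ^+ 2 = (y * q ^+ j) ^+ 2 by rewrite exprMn.
have -> : q ^+ j.+1 * (A / (q ^+ m)^-1) = w * q ^+ j.
  by rewrite Ay /y /w /N !exprD exprS; field; nz.
have -> : q ^+ j.+1 * (A / y) = y * q ^+ j by rewrite Ay exprS; field; nz.
rewrite qpoch_sqr -mulNr (qpochB (- y) q jk).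
have wj := qpoch_neq0W jk wk.
move: (wk); rewrite (qpochB w q jk) mulf_eq0 negb_or => /andP[_ wkj].
have -> : q ^+ j / q ^+ (2 * N).+1 = A * q ^+ j by rewrite mulrC.
have PA : P (A * q ^+ j) k.+1 = P (A * q ^+ j) j * (1 - A * q ^+ (2 * j)) * P ((y * q ^+ j) ^+ 2) (k - j).
  rewrite -{1}(subnKC jk) -addnS qpochD qpochSl.
  have -> : A * q ^+ j * q ^+ j = A * q ^+ (2 * j) by rewrite qM2; ring.
  have -> : A * q ^+ (2 * j) * q = (y * q ^+ j) ^+ 2 by rewrite Ay qM2; field; nz.
  by rewrite mulrA.
have : P (A * q ^+ j) k.+1 != 0.
  rewrite qpoch_neq0; apply/forallP => -[i ik] /=.
  by rewrite -mulrA -exprD hA //; lia.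
rewrite PA !mulf_eq0 !negb_or => /andP[/andP[h1 h2] h3].
rewrite /gbinom jk exprVn [(q ^+ n * q) ^+ j]exprMn -[q ^+ n ^+ j]exprM.
have -> : q ^+ k = q ^+ j * q ^+ (k - j) by rewrite -exprD subnKC.
have yk : P (y * q ^+ j) (k - j) != 0.
  have : P y k != 0 by rewrite qpochV_neq0.
  by rewrite (qpochB y q jk) mulf_eq0 negb_or => /andP[].
by field; nz.
Qed.

Lemma sum_ord_widen0 m n (h : nat -> F) : (m <= n)%N ->
  (forall k, (m < k)%N -> h k = 0) -> \sum_(k < m.+1) h k = \sum_(k < n.+1) h k.
Proof.
move=> mn h0; rewrite -!(big_mkord xpredT) [RHS](big_cat_nat (n := m.+1)) //=.
rewrite [X in _ = _ + X]big_nat_cond [X in _ = _ + X]big1 ?addr0 // => k /andP[/andP[mk _] _].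
exact: h0.
Qed.

(** [qWatson_connection] writes each coefficient on the left as a sum over j; after the interchange,
    the sum over s = k - j is [qWatson] at q^j A, q^j B and m + n - j. *)
Lemma qWatson_double m n A B : P2 (q * (A * B)) (m + n) != 0 ->
  \sum_(k < n.+1) P (q ^+ n)^-1 k * P (- (q ^+ (m + n))^-1) k
     / (P q k * P (q ^+ (m + n + n))^-1 k) * q ^+ k
     * (P A k * P B k / P2 (q * (A * B)) k)
  = \sum_(j < m.+1) (-1) ^+ j * q ^+ 'C(j.+1, 2) / q ^+ (n * j)
     * (P (q ^+ m)^-1 j * P (q ^+ (m + n))^-1 j * P (- (q ^+ (m + n))^-1) j)
     / (P q j * P (q ^+ (m + n + n))^-1 j * P (q ^+ j / q ^+ (2 * (m + n)).+1) j)
     * (P A j * P B j / P2 (q * (A * B)) j)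
     * (P2 (q ^+ j.+1 * A) (m + n - j) * P2 (q ^+ j.+1 * B) (m + n - j)
        / (P2 q (m + n - j) * P2 (q ^+ (2 * j).+1 * (A * B)) (m + n - j))).
Proof.
move=> h0; pose f k := P (q ^+ n)^-1 k * P (- (q ^+ (m + n))^-1) k
     / (P q k * P (q ^+ (m + n + n))^-1 k) * q ^+ k
     * (P A k * P B k / P2 (q * (A * B)) k).
pose g j := (-1) ^+ j * q ^+ 'C(j.+1, 2) / q ^+ (n * j)
     * (P (q ^+ m)^-1 j * P (q ^+ (m + n))^-1 j * P (- (q ^+ (m + n))^-1) j)
     / (P q j * P (q ^+ (m + n + n))^-1 j * P (q ^+ j / q ^+ (2 * (m + n)).+1) j)
     * (P A j * P B j / P2 (q * (A * B)) j)
     * (P2 (q ^+ j.+1 * A) (m + n - j) * P2 (q ^+ j.+1 * B) (m + n - j)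
        / (P2 q (m + n - j) * P2 (q ^+ (2 * j).+1 * (A * B)) (m + n - j))).
(* Both sums are extended to m + n: (q^(-n); q)_k vanishes for k > n and (q^(-m); q)_j for j > m. *)
rewrite (@sum_ord_widen0 n (m + n) f (leq_addl m n)); last first.
  by move=> k nk; rewrite /f qpoch_neg0 // !mul0r.
rewrite (@sum_ord_widen0 m (m + n) g (leq_addr n m)); last first.
  by move=> k nk; rewrite /g (qpoch_neg0 q0 nk) !(mul0r, mulr0).
rewrite {}/f {}/g; set N := (m + n)%N in h0 *.
pose h k j := (-1) ^+ j * q ^+ 'C(j.+1, 2) / q ^+ (n * j)
     * (P (q ^+ m)^-1 j * P (q ^+ N)^-1 j * P (- (q ^+ N)^-1) j)
     / (P q j * P (q ^+ (N + n))^-1 j * P (q ^+ j / q ^+ (2 * N).+1) j)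
     * (P2 (q ^+ (2 * (N - j)))^-1 (k - j)
        / (P q (k - j) * P (q ^+ (2 * (N - j)))^-1 (k - j)) * q ^+ (k - j))
     * (P A k * P B k / P2 (q * (A * B)) k).
transitivity (\sum_(k < N.+1) \sum_(j < k.+1) h k j).
  apply: eq_bigr => -[k /=]; rewrite ltnS => kN _.
  by rewrite -(qWatson_connection kN) mulr_suml.
rewrite sum_triangle; apply: eq_bigr => -[j /=]; rewrite ltnS => jN _.
have eAB : q * (q ^+ j * A * (q ^+ j * B)) = q ^+ (2 * j).+1 * (A * B).
  by rewrite exprS qM2; ring.
have eAB2 : q ^+ (2 * j).+1 * (A * B) = q * (A * B) * (q ^+ 2) ^+ j.
  by rewrite exprS q2E qM2; ring.
have := h0; rewrite (qpochB _ _ jN) mulf_eq0 negb_or => /andP[h1 h2].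
have := @qWatson (q ^+ j * A) (q ^+ j * B) (N - j).
rewrite eAB {1}eAB2 => /(_ h2) W.
rewrite !(mulrA q (q ^+ j)) -exprS in W.
rewrite {}W mulr_sumr; apply: eq_bigr => -[s /=] _ _.
rewrite /h addKn !qpochD -eAB2 !(mulrC _ (q ^+ j)) !invfM.
by ring.
Qed.

(** The terminating 6phi5 sum with A = q/c^2, b = B q^k and d = -q/c, where B = q^(l+1) a/c^2. Since
    d^2 = q A, the factors (d; q)_i and (q^(i+1) A/d; q)_(l-i) multiply to (d; q)_l, free of i; and
    (B; q)_i (B q^i; q)_k = (B; q)_k (b; q)_i. *)
Lemma qsix_phi_five_shift a c l k : a != 0 -> c != 0 -> P a l != 0 ->
  (forall s, (s <= 2 * l)%N -> 1 - q / c ^+ 2 * q ^+ s != 0) ->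
  P (- (q / c)) l != 0 ->
  \sum_(i < l.+1) (-1) ^+ i * (c / a) ^+ i
     * ((1 - q / c ^+ 2 * q ^+ (2 * i)) / (1 - q / c ^+ 2))
     * (P (q ^+ l)^-1 i * P (q ^+ l.+1 * a / c ^+ 2) i * P (q / c ^+ 2) i
        / (P q i * P (q / (q ^+ l * a)) i * P (q / c ^+ 2 * q ^+ l.+1) i))
     * (P (q ^+ (l - i) * a) k * P (q ^+ l.+1 * a / c ^+ 2 * q ^+ i) k)
  = (- (c / q)) ^+ l * P (q ^+ 2 / c ^+ 2) l * P (- (q ^+ k.+1 * a / c)) l
    / (P a l * P (- (q / c)) l) * (P a k * P (q ^+ l.+1 * a / c ^+ 2) k).
Proof.
move=> a0 c0 Pa0 hA Pd0.
set A := q / c ^+ 2 in hA *; set d := - (q / c) in Pd0 *.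
set B := q ^+ l.+1 * a / c ^+ 2; pose b := B * q ^+ k.
have A0 : A != 0 by rewrite /A; nz.
have d0 : d != 0 by rewrite /d; nz.
have b0 : b != 0 by rewrite /b /B; nz.
have := @qsix_phi_five A b d l b0 d0 hA.
(* The 6phi5 sum evaluates to (q^(1-l)/x; q)_l, which reverses to (x; q)_l. *)
pose x := - (q ^+ k.+1 * a / c).
have x0 : x != 0 by rewrite /x; nz.
have Abd : A / (b * d) = (q ^+ l * x)^-1.
  by rewrite /A /b /B /d /x !exprS; field; nz.
rewrite Abd (qpoch_rev _ x0 q0) -/x => E.
pose K := P (q ^+ 2 / c ^+ 2) l * (P B k * P a k) / (P a l * P d l)
   * ((- a) ^+ l * q ^+ (k * l) * q ^+ 'C(l, 2)).
transitivity (K * ((-1 / x) ^+ l / q ^+ 'C(l, 2) * P x l)); last first.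
  have -> : - (c / q) = (- a) * q ^+ k * (- 1 / x) by rewrite /x exprS; field; nz.
  rewrite /K [in RHS]exprMn [((- a) * _) ^+ l]exprMn -[(q ^+ k) ^+ l]exprM.
  by field; nz.
rewrite -E mulr_sumr; apply: eq_bigr => -[i /=]; rewrite ltnS => il _.
set p := (l - i)%N.
have lp : l = (i + p)%N by rewrite subnKC.
have Adi : q ^+ i.+1 * (A / d) = d * q ^+ i by rewrite /A /d exprS; field; nz.
have Abi : q ^+ i.+1 * (A / b) = q / (q ^+ p * (a * q ^+ k)).
  by rewrite /A /b /B exprS [q ^+ l.+1]exprS lp exprD; field; nz.
have ak0 : a * q ^+ k != 0 by nz.
have ap0 : a * q ^+ p != 0 by nz.
rewrite Adi Abi (qpoch_rev _ ak0 q0).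
have -> : q / (q ^+ l * a) = q / (q ^+ i * (a * q ^+ p)) by rewrite lp exprD; field; nz.
rewrite (qpoch_rev _ ap0 q0).
have E1 : P (a * q ^+ p) k = P a k * P (a * q ^+ k) p / P a p.
  have : P a l != 0 by []. rewrite lp addnC qpochD mulf_eq0 negb_or => /andP[h _].
  by rewrite -qpochD addnC qpochD; field.
rewrite (mulrC (q ^+ p) a) E1.
have E2 : P B i * P (B * q ^+ i) k = P B k * P b i.
  by rewrite -qpochD addnC qpochD.
have hP j n : (j + n <= (2 * l).+1)%N -> P (A * q ^+ j) n != 0.
  move=> hjn; rewrite qpoch_neq0; apply/forallP => -[s hs] /=.
  by rewrite -mulrA -exprD hA // -ltnS (leq_trans _ hjn) // ltn_add2l.
have Ai0 : P (A * q ^+ i) l.+1 != 0.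
  by apply: hP; rewrite addnS ltnS mul2n -addnn leq_add2r.
have Al0 : P (A * q ^+ l.+1) i != 0.
  by apply: hP; rewrite addSn ltnS mul2n -addnn leq_add2l.
have A1 : 1 - A != 0 by have := hA 0%N isT; rewrite expr0 mulr1.
have E3 : P A i = (1 - A) * P (q ^+ 2 / c ^+ 2) l * P (A * q ^+ l.+1) i / P (A * q ^+ i) l.+1.
  have -> : q ^+ 2 / c ^+ 2 = A * q by rewrite /A; field; nz.
  by rewrite -qpochSl -qpochD addnC qpochD mulfK.
have E4 := qpoch_neg_gbinom il.
have E5 : P a l = P a p * P (a * q ^+ p) i by rewrite -qpochD addnC -lp.
have E6 : P d l = P d i * P (d * q ^+ i) p by rewrite -qpochD -lp.
move: (Pa0) (Pd0); rewrite E5 E6 !mulf_eq0 !negb_or => /andP[h1 h2] /andP[h3 h4].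
have sg0 : (-1) ^+ i != 0 :> F by rewrite signr_eq0.
have e1 : (- 1 / (a * q ^+ p)) ^+ i = (-1) ^+ i / (a ^+ i * q ^+ (i * p)).
  by rewrite !exprMn exprVn exprMn (mulnC i) exprM.
have e2 : (- 1 / (a * q ^+ k)) ^+ p = ((- a) ^+ p * q ^+ (k * p))^-1.
  by rewrite exprM -exprMn -exprVn; congr (_ ^+ _); field; nz.
have e3 : (q ^+ l * x)^-1 ^+ i = c ^+ i / ((-1) ^+ i * q ^+ (l * i) * q ^+ (k * i) * q ^+ i * a ^+ i).
  rewrite !exprM -!exprMn -expr_div_n; congr (_ ^+ _).
  by rewrite /x exprS; field; nz.
have e4 : (- a) ^+ l = (-1) ^+ i * a ^+ i * (- a) ^+ p.
  by rewrite lp exprD -exprMn mulN1r.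
have e5 : q ^+ (k * l) = q ^+ (k * i) * q ^+ (k * p) by rewrite lp mulnDr exprD.
have e6 : q ^+ 'C(l, 2) = q ^+ 'C(i, 2) * q ^+ 'C(p, 2) * q ^+ (i * p).
  by rewrite -!exprD -bin2D -lp.
have e7 : q ^+ (l * i) = q ^+ 'C(i, 2) * q ^+ 'C(i, 2) * q ^+ i * q ^+ (i * p).
  by rewrite -!exprD -mulnn_bin2 -mulnDr -lp mulnC.
have e8 : q ^+ 'C(i.+1, 2) = q ^+ 'C(i, 2) * q ^+ i by rewrite binS bin1 exprD.
have na0 : (- a) ^+ p != 0 by nz.
transitivity ((-1) ^+ i * (c / a) ^+ i * ((1 - A * q ^+ (2 * i)) / (1 - A)) *
  (P (q ^+ l)^-1 i / P q i) * (P B i * P (B * q ^+ i) k) * P A i /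
  (((-1) ^+ i / (a ^+ i * q ^+ (i * p)) / q ^+ 'C(i, 2) * P (a * q ^+ p) i) *
    P (A * q ^+ l.+1) i) * (P a k * P (a * q ^+ k) p / P a p)).
  by rewrite e1; field; nz.
rewrite E4 E2 E3 /K E5 E6 e2 e3 e4 e5 e6 e7 e8 expr_div_n.
by field; nz.
Qed.
End NotRootOfUnity.

(** * The identity for q not a root of unity *)

Section Assembly.
Set Implicit Arguments.
Unset Strict Implicit.
Variables (F : fieldType) (q : F).
Hypothesis q0 : q != 0.
Implicit Types (a c : F) (i j k l m n : nat).
Local Notation P x n := (qpoch x q n).
Local Notation P2 x n := (qpoch x (q ^+ 2) n).

Lemma exprz_natB (z : int) u v : z = u%:Z - v%:Z -> q ^ z = q ^+ u / q ^+ v.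
Proof. by move=> ->; rewrite expfzDr // -exprnN. Qed.

(* Only [A = q^(l-i) a] and [B = q^(l+1+i) a / c^2] tie the factor in [j] to [i],
   and [q A B] is the square of [q^(l+1) a / c]. *)
Lemma T_factor a c l m n i j : a != 0 -> c != 0 -> (i <= l)%N ->
  T q a c l m n i j =
  (-1) ^+ i * (c / a) ^+ i
     * ((1 - q / c ^+ 2 * q ^+ (2 * i)) / (1 - q / c ^+ 2))
     * (P (q ^+ l)^-1 i * P (q ^+ l.+1 * a / c ^+ 2) i * P (q / c ^+ 2) i
        / (P q i * P (q / (q ^+ l * a)) i * P (q / c ^+ 2 * q ^+ l.+1) i))
  * ((-1) ^+ j * q ^+ 'C(j.+1, 2) / q ^+ (n * j)
     * (P (q ^+ m)^-1 j * P (q ^+ (m + n))^-1 j * P (- (q ^+ (m + n))^-1) j)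
     / (P q j * P (q ^+ (m + n + n))^-1 j * P (q ^+ j / q ^+ (2 * (m + n)).+1) j)
     * (P (q ^+ (l - i) * a) j * P (q ^+ l.+1 * a / c ^+ 2 * q ^+ i) j
        / P2 ((q ^+ l.+1 * a / c) ^+ 2) j)
     * (P2 (q ^+ j.+1 * (q ^+ (l - i) * a)) (m + n - j)
        * P2 (q ^+ j.+1 * (q ^+ l.+1 * a / c ^+ 2 * q ^+ i)) (m + n - j)
        / (P2 q (m + n - j) * P2 ((q ^+ l.+1 * a / c) ^+ 2 * (q ^+ 2) ^+ j) (m + n - j)))).
Proof.
move=> a0 c0 il; have eZ := exprz_natB.
rewrite /T /Tden_c /Tden_i /Tden_j /Tden_mnj /qpochs !big_cons !big_nil !mulr1.
have -> : q ^ ('C(j.+1, 2)%:Z - n%:Z * j%:Z) = q ^+ 'C(j.+1, 2) / q ^+ (n * j).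
  by apply: eZ; rewrite PoszM.
have -> : q ^ (- l%:Z) = (q ^+ l)^-1 by rewrite -exprnN.
have -> : q ^ (- m%:Z) = (q ^+ m)^-1 by rewrite -exprnN.
have -> : q ^ (1 - l%:Z) / a = q / (q ^+ l * a).
  by rewrite (eZ _ 1%N l) // invfM mulrA.
have -> : q ^ (- m%:Z - n%:Z) = (q ^+ (m + n))^-1.
  by rewrite (eZ _ 0%N (m + n)%N) ?expr0 ?div1r //; lia.
have -> : q ^ (- m%:Z - 2 * n%:Z) = (q ^+ (m + n + n))^-1.
  by rewrite (eZ _ 0%N (m + n + n)%N) ?expr0 ?div1r //; lia.
have -> : q ^ (j%:Z - 2 * m%:Z - 2 * n%:Z - 1) = q ^+ j / q ^+ (2 * (m + n)).+1.
  by apply: eZ; lia.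
have -> : q ^ (1 + l%:Z - i%:Z + j%:Z) * a = q ^+ j.+1 * (q ^+ (l - i) * a).
  by rewrite (eZ _ (j.+1 + (l - i))%N 0%N) ?expr0 ?divr1 ?exprD ?mulrA //; lia.
have -> : q ^ (l%:Z - i%:Z) = q ^+ (l - i) by rewrite subzn.
have -> : q ^+ (1 + 2 * i) / c ^+ 2 = q / c ^+ 2 * q ^+ (2 * i).
  by rewrite exprD mulrAC.
have -> : q ^+ (2 + l) / c ^+ 2 = q / c ^+ 2 * q ^+ l.+1 by rewrite addSn exprS mulrAC.
have -> : q ^+ (1 + l + i) * a / c ^+ 2 = q ^+ l.+1 * a / c ^+ 2 * q ^+ i.
  by rewrite exprD; ring.
have -> : q ^+ (2 + l + i + j) * a / c ^+ 2
    = q ^+ j.+1 * (q ^+ l.+1 * a / c ^+ 2 * q ^+ i).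
  by rewrite !exprD !exprS; ring.
have -> : q ^+ (2 + 2 * l + 2 * j) * a ^+ 2 / c ^+ 2
    = (q ^+ l.+1 * a / c) ^+ 2 * (q ^+ 2) ^+ j.
  have -> : (2 + 2 * l = l.+1 * 2)%N by rewrite [RHS]mulnC mulnS.
  by rewrite exprD !exprM !exprMn exprVn; ring.
rewrite qpoch_sqr !invfM exprD.
by ring.
Qed.

(** [qWatson_double] for each i, then [qsix_phi_five_shift] for each k, turn the double sum into a
    sum over k <= n, which matches the Sears transform of the left-hand side term by term. *)
Lemma generic_identity a c l m n : (forall k, (0 < k)%N -> q ^+ k != 1) ->
  a != 0 -> c != 0 ->
  P (q ^+ l.+1 * a / c) n != 0 -> P (q ^+ (1 + m + n) * a) n != 0 ->
  P (- ((q ^+ n)^-1 * c)) n != 0 ->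
  P a l != 0 -> P (- (q * a / c)) l != 0 ->
  (forall s, (s <= 2 * l)%N -> 1 - q / c ^+ 2 * q ^+ s != 0) ->
  P2 ((q ^+ l.+1 * a / c) ^+ 2) (m + n) != 0 ->
  phi43 n a c (q ^ (- n%:Z)) (- (q ^+ (1 + l + m + n) * a / c))
    (q ^+ (1 + l) * a / c) (q ^+ (1 + m + n) * a) (- (q ^ (- n%:Z) * c)) q q
  = qpochs [:: a; - (q ^ (- l%:Z) * c)] q l
    / qpochs [:: q ^ (- l%:Z - 1) * c ^+ 2; - (q * a / c)] q l
    * (qpochs [:: q ^+ (1 + m + n); - (q * a / c)] q n
       / qpochs [:: q ^+ (1 + m + n) * a; - (q / c)] q n)
    * \sum_(0 <= i < l.+1) \sum_(0 <= j < m.+1) T q a c l m n i j.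
Proof.
move=> q1 a0 c0 hD he hf hal hqal hA hD2.
have qX k : q ^+ k != 0 by rewrite expf_neq0.
have -> : q ^ (- n%:Z) = (q ^+ n)^-1 by rewrite -exprnN.
have -> : q ^ (- l%:Z) = (q ^+ l)^-1 by rewrite -exprnN.
have -> : q ^ (- l%:Z - 1) = (q ^+ l.+1)^-1.
  by rewrite (@exprz_natB _ 0%N l.+1) ?expr0 ?div1r //; lia.
pose y := (q ^+ (m + n))^-1; pose w := (q ^+ (m + n + n))^-1.
pose D := q ^+ l.+1 * a / c; pose B := q ^+ l.+1 * a / c ^+ 2.
pose g k := P (q ^+ n)^-1 k * P (- y) k / (P q k * P w k) * q ^+ k.
have wn : P w n != 0 by rewrite qpochV_neq0 //; apply: leq_addl.
(* (-qa/c; q)_(l+m+n) is (-qa/c; q)_l (-D; q)_(m+n), and (-D; q)_(m+n) divides (D^2; q^2)_(m+n). *)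
have hqan : P (- (q * a / c)) n != 0.
  have : P (- (q * a / c)) (l + (m + n)) != 0.
    rewrite qpochD mulf_neq0 //.
    have -> : - (q * a / c) * q ^+ l = - D by rewrite /D exprS; ring.
    by move: hD2; rewrite qpoch_sqr mulf_eq0 negb_or => /andP[].
  by apply: qpoch_neq0W; rewrite addnA leq_addl.
have dqc0 : - (q / c) != 0 by nz.
have hqcn : P (- (q / c)) n != 0.
  move: hf; have -> : - ((q ^+ n)^-1 * c) = q / (q ^+ n * - (q / c)) by field; nz.
  by rewrite (qpoch_rev _ dqc0 q0) mulf_eq0 negb_or => /andP[].
(* 1 - q^(2s+2)/c^2 contains the factor 1 + q^(s+1)/c. *)
have hqcl : P (- (q / c)) l != 0.
  rewrite qpoch_neq0; apply/forallP => -[s hs] /=.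
  have := hA (2 * s).+1; rewrite ltn_mul2l /= => /(_ hs) h.
  apply: contraNneq h => h.
  have -> : 1 - q / c ^+ 2 * q ^+ (2 * s).+1 = (1 - - (q / c) * q ^+ s) * (1 - q / c * q ^+ s).
    by rewrite (exprS q (2 * s)) (mulnC 2) exprM; field; nz.
  by rewrite h mul0r.
have hq2l : P (q ^+ 2 / c ^+ 2) l != 0.
  rewrite qpoch_neq0; apply/forallP => -[s hs] /=.
  have -> : q ^+ 2 / c ^+ 2 * q ^+ s = q / c ^+ 2 * q ^+ s.+1 by rewrite (exprS q s); ring.
  by apply: hA; rewrite (leq_trans hs) // leq_pmull.
transitivity (\sum_(k < n.+1) P (q ^+ n)^-1 k * P a k * P c k * P (- (q ^+ (1 + l + m + n) * a / c)) k
      / (P q k * P D k * P (q ^+ (1 + m + n) * a) k * P (- ((q ^+ n)^-1 * c)) k) * q ^+ k).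
  apply: eq_bigr => k _; rewrite /qpochs !big_cons !big_nil !mulr1 !mulrA.
  by congr (_ * _ / _ * _); ring.
have e1 : q ^+ (1 + l + m + n) = q ^+ l.+1 * q ^+ (m + n) by rewrite -addnA exprD.
have e2 : q ^+ (1 + m + n) = q ^+ (m + n).+1 by rewrite -addnA.
have e3 : q / (q ^+ n * (q ^+ (1 + m + n) * a / a)) = w.
  by rewrite e2 /w exprS [q ^+ (m + n + n)]exprD; field; nz.
have e4 : q / (q ^+ n * (- ((q ^+ n)^-1 * c) / a)) = - (q * a / c) by field; nz.
(* D, q^(1+m+n) a and -q^(-n) c play the roles of d, e and f; the second remaining goal is the
   balance condition. *)
rewrite (qSears q0 q1) ?e3 ?e4 //; try by [rewrite /D; nz | nz].
  2: by rewrite e1 e2 /D (exprS q (m + n)); field; nz.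
(* R k is the closed form of the sum over i. *)
pose R k := (- (c / q)) ^+ l * P (q ^+ 2 / c ^+ 2) l * P (- (q ^+ k.+1 * a / c)) l
    / (P a l * P (- (q / c)) l) * (P a k * P B k).
have -> : \sum_(0 <= i < l.+1) \sum_(0 <= j < m.+1) T q a c l m n i j
    = \sum_(k < n.+1) g k / P2 (D ^+ 2) k * R k.
  (* The part of T_{i,j} that is free of j. *)
  pose kap i := (-1) ^+ i * (c / a) ^+ i
     * ((1 - q / c ^+ 2 * q ^+ (2 * i)) / (1 - q / c ^+ 2))
     * (P (q ^+ l)^-1 i * P (q ^+ l.+1 * a / c ^+ 2) i * P (q / c ^+ 2) i
        / (P q i * P (q / (q ^+ l * a)) i * P (q / c ^+ 2 * q ^+ l.+1) i)).
  transitivity (\sum_(i < l.+1) \sum_(k < n.+1) kap i * (g k / P2 (D ^+ 2) k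
      * (P (q ^+ (l - i) * a) k * P (B * q ^+ i) k))).
    rewrite big_mkord; apply: eq_bigr => -[i /=]; rewrite ltnS => il _.
    have AB : q * (q ^+ (l - i) * a * (B * q ^+ i)) = D ^+ 2.
      have e : q ^+ l = q ^+ (l - i) * q ^+ i by rewrite -exprD subnK.
      by rewrite /B /D (exprS q l) e; field; nz.
    have := @qWatson_double _ q q0 q1 m n (q ^+ (l - i) * a) (B * q ^+ i).
    rewrite AB => /(_ hD2) W.
    rewrite big_mkord -mulr_sumr; under eq_bigr => j _ do rewrite T_factor //.
    rewrite -mulr_sumr; congr (_ * _).
    transitivity (\sum_(k < n.+1) g k * (P (q ^+ (l - i) * a) k * P (B * q ^+ i) k / P2 (D ^+ 2) k)).
      rewrite [RHS]W; apply: eq_bigr => j _.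
      suff -> : q ^+ (2 * j).+1 * (q ^+ (l - i) * a * (B * q ^+ i)) = D ^+ 2 * (q ^+ 2) ^+ j by [].
      by rewrite -AB exprS exprM; ring.
    by apply: eq_bigr => k _; rewrite mulrA mulrAC.
  rewrite exchange_big /=; apply: eq_bigr => k _.
  rewrite /R -(qsix_phi_five_shift q0 q1 k a0 c0 hal hA hqcl) mulr_sumr.
  by apply: eq_bigr => i _; rewrite mulrCA.
rewrite !mulr_sumr; apply: eq_bigr => -[k /=]; rewrite ltnS => kn _.
have -> : D / c = B by rewrite /D /B; field; nz.
have -> : D / - (q ^+ (1 + l + m + n) * a / c) = - y by rewrite e1 /D /y; field; nz.
have -> : q ^+ (1 + m + n) * a / a = q ^+ (1 + m + n) by rewrite mulfK.
have hqa0 : - (q * a / c) != 0 by nz.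
have -> : - ((q ^+ n)^-1 * c) / a = q / (q ^+ n * - (q * a / c)) by field; nz.
have ef : - ((q ^+ n)^-1 * c) = q / (q ^+ n * - (q / c)) by field; nz.
have -> : - ((q ^+ l)^-1 * c) = q / (q ^+ l * - (q / c)) by field; nz.
have x2 : q ^+ 2 / c ^+ 2 != 0 by nz.
have -> : (q ^+ l.+1)^-1 * c ^+ 2 = q / (q ^+ l * (q ^+ 2 / c ^+ 2)) by rewrite (exprS q l); field; nz.
rewrite ef /qpochs !big_cons !big_nil !mulr1.
rewrite !(qpoch_rev _ hqa0 q0) !(qpoch_rev _ dqc0 q0) (qpoch_rev _ x2 q0) /R /g.
(* (-qa/c; q)_(k+l) is split after k factors and after l factors. The resulting (-D; q)_k cancels
   half of (D^2; q^2)_k, and (-qa/c; q)_k is a denominator of the Sears transform. *)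
have El : P (- (q ^+ k.+1 * a / c)) l = P (- (q * a / c)) l * P (- D) k / P (- (q * a / c)) k.
  have -> : - D = - (q * a / c) * q ^+ l by rewrite /D exprS; ring.
  have -> : - (q ^+ k.+1 * a / c) = - (q * a / c) * q ^+ k by rewrite exprS; ring.
  apply: (mulIf (qpoch_neq0W kn hqan)); rewrite mulfVK ?(qpoch_neq0W kn) //.
  by rewrite mulrC -!qpochD addnC.
rewrite El qpoch_sqr.
have hk : P (- D) k != 0.
  have : P2 (D ^+ 2) k != 0 by apply: qpoch_neq0W hD2; rewrite (leq_trans kn) // leq_addl.
  by rewrite qpoch_sqr mulf_eq0 negb_or => /andP[].
have hDk := qpoch_neq0W kn hD; have hwk := qpoch_neq0W kn wn; have hqk := qpoch_neq0W kn hqan.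
have hqqk : P q k != 0.
  by rewrite qpoch_neq0; apply/forallP => s; rewrite -exprS subr_eq0 eq_sym q1.
have f1 : (- 1 / - (q * a / c)) ^+ n = (c / q) ^+ n / a ^+ n.
  by rewrite -expr_div_n; congr (_ ^+ _); field; nz.
have f2 k' : (- 1 / - (q / c)) ^+ k' = (c / q) ^+ k'.
  by congr (_ ^+ _); field; nz.
have f3 : (- 1 / (q ^+ 2 / c ^+ 2)) ^+ l = (c / q) ^+ l * (- (c / q)) ^+ l.
  by rewrite -exprMn; congr (_ ^+ _); field; nz.
rewrite f1 !f2 f3.
by field; nz.
Qed.
End Assembly.

(** * Values of rational functions at X = 0 *)

Section Specialization.
Set Implicit Arguments.
Unset Strict Implicit.
Variable F : fieldType.
Local Notation K := {fraction {poly F}}.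
Local Notation "p %:F" := (tofrac p : K).
Implicit Types (x z : K) (y t : F) (p r : {poly F}).

(** The rational function x is regular at X = 0 and takes the value y there. It is a relation
    because evaluation at 0 is only partial on F(X). *)
Definition specializes x y :=
  exists p r, [/\ r.[0] != 0, x * r%:F = p%:F & y * r.[0] = p.[0]].

Lemma specializes_tofrac p : specializes p%:F p.[0].
Proof. by exists p, 1; rewrite tofrac1 hornerC oner_neq0 !mulr1. Qed.

Lemma specializesC y : specializes (y%:P)%:F y.
Proof. by rewrite -{2}(hornerC y 0); apply: specializes_tofrac. Qed.

Lemma specializes1 : specializes 1 1.
Proof. by have := specializesC 1; rewrite tofrac1. Qed.

Lemma specializes0 : specializes 0 0.
Proof. by have := specializesC 0; rewrite tofrac0. Qed.

Lemma specializesD x y z t :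
  specializes x y -> specializes z t -> specializes (x + z) (y + t).
Proof.
move=> [p [r [r0 xr yr]]] [p' [r' [r'0 zr tr]]].
exists (p * r' + p' * r), (r * r'); rewrite ?hornerD !hornerM mulf_neq0 //.
split=> //; last by rewrite -yr -tr; ring.
by rewrite tofracD !tofracM -xr -zr mulrDl mulrA (mulrC r%:F) mulrA.
Qed.

Lemma specializesM x y z t :
  specializes x y -> specializes z t -> specializes (x * z) (y * t).
Proof.
move=> [p [r [r0 xr yr]]] [p' [r' [r'0 zr tr]]].
exists (p * p'), (r * r'); rewrite ?hornerD !hornerM mulf_neq0 //.
split=> //; last by rewrite -yr -tr; ring.
by rewrite !tofracM -xr -zr mulrACA.
Qed.

Lemma specializesN x y : specializes x y -> specializes (- x) (- y).
Proof.
by move=> /(specializesM (specializesC (- 1))); rewrite rmorphN rmorph1 tofracN tofrac1 !mulN1r.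
Qed.

(** If x were 0, its numerator p would be 0, hence also y r(0). This carries the nonvanishing
    hypotheses from q to q + X. *)
Lemma specializes_neq0 x y : specializes x y -> y != 0 -> x != 0.
Proof.
move=> [p [r [r0 xr yr]]] y0; apply: contraNneq y0 => x0.
move: xr; rewrite x0 mul0r => /esym/eqP; rewrite tofrac_eq0 => /eqP p0.
by move: yr; rewrite p0 horner0 => /eqP; rewrite mulf_eq0 (negPf r0) orbF.
Qed.

Lemma specializesV x y : y != 0 -> specializes x y -> specializes x^-1 y^-1.
Proof.
move=> y0 sp; have x0 := specializes_neq0 sp y0; case: sp => p [r [r0 xr yr]].
exists r, p; rewrite -xr -yr mulf_neq0 //.
by rewrite !mulKf.
Qed.

(** The difference x - x = 0 takes the value y - t, which [specializes_neq0] forces to be 0. *)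
Lemma specializes_inj x y t : specializes x y -> specializes x t -> y = t.
Proof.
move=> sxy sxt; have := specializesD sxy (specializesN sxt); rewrite subrr => s0.
apply/eqP; rewrite -subr_eq0; apply: contraT => /(specializes_neq0 s0).
by rewrite eqxx.
Qed.

Lemma specializesX x y n : specializes x y -> specializes (x ^+ n) (y ^+ n).
Proof.
move=> sxy; elim: n => [|n IH]; first exact: specializes1.
by rewrite !exprS; apply: specializesM.
Qed.

Lemma specializes_exprz x y (k : int) : y != 0 ->
  specializes x y -> specializes (x ^ k) (y ^ k).
Proof.
move=> y0 sxy; case: k => n; first exact: specializesX.
by rewrite !NegzE -!exprnN; apply/specializesV/specializesX; rewrite ?expf_neq0.
Qed.

Lemma specializes_sum n (f : nat -> K) (g : nat -> F) :
  (forall k, (k < n)%N -> specializes (f k) (g k)) ->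
  specializes (\sum_(0 <= k < n) f k) (\sum_(0 <= k < n) g k).
Proof.
move=> fg; elim: n fg => [|n IH] fg; first by rewrite !big_geq //; apply: specializes0.
rewrite !big_nat_recr //=; apply: specializesD; last exact: fg.
by apply: IH => k kn; apply/fg/leqW.
Qed.

Lemma specializes_qpoch x y z t n :
  specializes x y -> specializes z t -> specializes (qpoch x z n) (qpoch y t n).
Proof.
move=> sx sz; elim: n => [|n IH]; first by rewrite !qpoch0; apply: specializes1.
rewrite !qpochS; apply: specializesM => //; apply: specializesD; first exact: specializes1.
by apply/specializesN/specializesM/specializesX.
Qed.

Lemma specializes_qpochs_nil z t n : specializes (qpochs [::] z n) (qpochs [::] t n).
Proof. by rewrite /qpochs !big_nil; apply: specializes1. Qed.

Lemma specializes_qpochs_cons x y z t xs ys n : specializes z t ->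
  specializes x y -> specializes (qpochs xs z n) (qpochs ys t n) ->
  specializes (qpochs (x :: xs) z n) (qpochs (y :: ys) t n).
Proof.
by move=> sz sx sxs; rewrite /qpochs !big_cons; apply: specializesM => //; apply: specializes_qpoch.
Qed.

End Specialization.

(** * Transfer of the identity to every nonzero q *)

Ltac specialize_tac := repeat match goal with
  | |- specializes (_ ^+ _) _ => apply: specializesX
  | |- specializes (_ ^ _) _ => apply: specializes_exprz
  | |- specializes (_^-1) _ => apply: specializesV
  | |- specializes (_ * _) _ => apply: specializesM
  | |- specializes (_ + _) _ => apply: specializesD
  | |- specializes (- _) _ => apply: specializesN
  | |- specializes (qpochs [::] _ _) _ => apply: specializes_qpochs_nil
  | |- specializes (qpochs _ _ _) _ => apply: specializes_qpochs_cons
  | |- specializes (qpoch _ _ _) _ => apply: specializes_qpoch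
  | |- specializes 1 _ => apply: specializes1
  | |- _ => assumption
  end.

Lemma double_sum_identity (F : fieldType) (q a c : F) (l m n : nat)
  (hq : q != 0) (ha : a != 0) (hc : c != 0)
  (hphi : forall k : nat, (k <= n)%N ->
     qpochs [:: q; q ^+ (1 + l) * a / c; q ^+ (1 + m + n) * a;
                - (q ^ (- n%:Z) * c)] q k != 0)
  (hpre_l : qpochs [:: q ^ (- l%:Z - 1) * c ^+ 2; - (q * a / c)] q l != 0)
  (hpre_n : qpochs [:: q ^+ (1 + m + n) * a; - (q / c)] q n != 0)
  (hTc : Tden_c q c != 0)
  (hTi : forall i : nat, (i <= l)%N -> Tden_i q a c l i != 0)
  (hTj : forall j : nat, (j <= m)%N -> Tden_j q a c l m n j != 0)
  (hTmnj : forall j : nat, (j <= m)%N -> Tden_mnj q a c l m n j != 0) :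
  phi43 n a c (q ^ (- n%:Z)) (- (q ^+ (1 + l + m + n) * a / c))
    (q ^+ (1 + l) * a / c) (q ^+ (1 + m + n) * a) (- (q ^ (- n%:Z) * c)) q q
  = qpochs [:: a; - (q ^ (- l%:Z) * c)] q l
    / qpochs [:: q ^ (- l%:Z - 1) * c ^+ 2; - (q * a / c)] q l
    * (qpochs [:: q ^+ (1 + m + n); - (q * a / c)] q n
       / qpochs [:: q ^+ (1 + m + n) * a; - (q / c)] q n)
    * \sum_(0 <= i < l.+1) \sum_(0 <= j < m.+1) T q a c l m n i j.
Proof.
(* Q is q + X, written as X - (-q) to match the size lemma for powers. *)
pose Q : {fraction {poly F}} := tofrac ('X - (- q)%:P).
pose A : {fraction {poly F}} := tofrac a%:P.
pose C : {fraction {poly F}} := tofrac c%:P.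
have sQ : specializes Q q.
  by have := specializes_tofrac ('X - (- q)%:P); rewrite !hornerE opprK.
have sA : specializes A a := specializesC a.
have sC : specializes C c := specializesC c.
have sphi : specializes
  (phi43 n A C (Q ^ (- n%:Z)) (- (Q ^+ (1 + l + m + n) * A / C))
    (Q ^+ (1 + l) * A / C) (Q ^+ (1 + m + n) * A) (- (Q ^ (- n%:Z) * C)) Q Q)
  (phi43 n a c (q ^ (- n%:Z)) (- (q ^+ (1 + l + m + n) * a / c))
    (q ^+ (1 + l) * a / c) (q ^+ (1 + m + n) * a) (- (q ^ (- n%:Z) * c)) q q).
  rewrite /phi43 -!(big_mkord xpredT (fun k => qpochs _ _ k / qpochs _ _ k * _ ^+ k)).
  apply: specializes_sum => k kn; specialize_tac; exact: hphi.
have spre : specializes (qpochs [:: A; - (Q ^ (- l%:Z) * C)] Q l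
    / qpochs [:: Q ^ (- l%:Z - 1) * C ^+ 2; - (Q * A / C)] Q l
    * (qpochs [:: Q ^+ (1 + m + n); - (Q * A / C)] Q n
       / qpochs [:: Q ^+ (1 + m + n) * A; - (Q / C)] Q n))
   (qpochs [:: a; - (q ^ (- l%:Z) * c)] q l
    / qpochs [:: q ^ (- l%:Z - 1) * c ^+ 2; - (q * a / c)] q l
    * (qpochs [:: q ^+ (1 + m + n); - (q * a / c)] q n
       / qpochs [:: q ^+ (1 + m + n) * a; - (q / c)] q n)).
  by specialize_tac.
have c20 : c ^+ 2 != 0 by nz.
have qn0 : q ^+ n != 0 by nz.
have sT i j : (i <= l)%N -> (j <= m)%N -> specializes (T Q A C l m n i j) (T q a c l m n i j).
  move=> il jm; have di := hTi i il; have dj := hTj j jm; have dm := hTmnj j jm.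
  (* The denominators stay folded so that their nonvanishing is found among the hypotheses. *)
  have si : specializes (Tden_i Q A C l i) (Tden_i q a c l i) by rewrite /Tden_i; specialize_tac.
  have sj : specializes (Tden_j Q A C l m n j) (Tden_j q a c l m n j).
    by rewrite /Tden_j; specialize_tac.
  have sm : specializes (Tden_mnj Q A C l m n j) (Tden_mnj q a c l m n j).
    by rewrite /Tden_mnj; specialize_tac.
  have sc : specializes (Tden_c Q C) (Tden_c q c) by rewrite /Tden_c; specialize_tac.
  by rewrite /T; specialize_tac.
have sS : specializes (\sum_(0 <= i < l.+1) \sum_(0 <= j < m.+1) T Q A C l m n i j)
  (\sum_(0 <= i < l.+1) \sum_(0 <= j < m.+1) T q a c l m n i j).
  apply: specializes_sum => i il; apply: specializes_sum => j jm; exact: sT.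
(* A value at X = 0 is unique, so it suffices that both sides are values of one element of F(X),
   which [generic_identity] provides. *)
apply: specializes_inj (specializesM spre sS).
rewrite -generic_identity //.
- exact: specializes_neq0 sQ hq.
(* (X + q)^k has size k + 1, so it is not 1 when k > 0. *)
- move=> k k0; rewrite /Q -tofracXn -tofrac1 tofrac_eq; apply/eqP => /(congr1 (size : {poly F} -> nat)).
  by rewrite size_exp_XsubC size_poly1 => -[]; move: k0; case: k.
- exact: specializes_neq0 sA ha.
- exact: specializes_neq0 sC hc.
- apply: (@specializes_neq0 _ _ (qpoch (q ^+ l.+1 * a / c) q n)); first by specialize_tac.
  by have := hphi n (leqnn n); rewrite /qpochs !big_cons !mulf_eq0 !negb_or => /and5P[].
- apply: (@specializes_neq0 _ _ (qpoch (q ^+ (1 + m + n) * a) q n)); first by specialize_tac.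
  by have := hphi n (leqnn n); rewrite /qpochs !big_cons !mulf_eq0 !negb_or => /and5P[].
- apply: (@specializes_neq0 _ _ (qpoch (- ((q ^+ n)^-1 * c)) q n)); first by specialize_tac.
  by have := hphi n (leqnn n); rewrite /qpochs !big_cons !mulf_eq0 !negb_or -exprnN => /and5P[].
(* (a; q)_l is the reversal of (q^(1-l)/a; q)_l, a denominator at i = l. *)
- apply: (@specializes_neq0 _ _ (qpoch a q l)); first by specialize_tac.
  have := hTi l (leqnn l); rewrite /Tden_i /qpochs !big_cons !mulf_eq0 !negb_or => /and4P[_ + _ _].
  rewrite (exprz_natB _ (erefl : 1 - l%:Z = 1%N%:Z - l%:Z)) //.
  have -> : q ^+ 1 / q ^+ l / a = q / (q ^+ l * a) by rewrite invfM mulrA.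
  by rewrite qpoch_rev // mulf_eq0 negb_or => /andP[].
- apply: (@specializes_neq0 _ _ (qpoch (- (q * a / c)) q l)); first by specialize_tac.
  by move: hpre_l; rewrite /qpochs !big_cons !mulf_eq0 !negb_or => /and3P[].
(* 1 - q^(s+1)/c^2 is nonzero by [hTc] for s = 0, by reversing (q^(-l-1) c^2; q)_l in the prefactor
   for 1 <= s <= l, and by (q^(l+2)/c^2; q)_l, a denominator at i = l, for l < s <= 2l. *)
- move=> s sl; apply: (@specializes_neq0 _ _ (1 - q / c ^+ 2 * q ^+ s)); first by specialize_tac.
  have [->|s0] := posnP s; first by rewrite expr0 mulr1.
  have hqk k x : qpoch x q l != 0 -> (k < l)%N -> 1 - x * q ^+ k != 0.
    by rewrite qpoch_neq0 => /forallP h kl; have := h (Ordinal kl).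
  have [sl1|ls] := leqP s l.
    have h : qpoch (q ^+ 2 / c ^+ 2) q l != 0.
      move: hpre_l; rewrite /qpochs !big_cons !mulf_eq0 !negb_or => /and3P[+ _ _].
      rewrite (@exprz_natB _ _ hq _ 0%N l.+1); last by lia.
      have -> : q ^+ 0 / q ^+ l.+1 * c ^+ 2 = q / (q ^+ l * (q ^+ 2 / c ^+ 2)).
        by rewrite expr0 (exprS q l); field; nz.
      have x0 : q ^+ 2 / c ^+ 2 != 0 by nz.
      by rewrite (qpoch_rev _ x0 hq) mulf_eq0 negb_or => /andP[].
    have := hqk s.-1 _ h; rewrite prednK // => /(_ sl1).
    suff -> : q ^+ 2 / c ^+ 2 * q ^+ s.-1 = q / c ^+ 2 * q ^+ s by [].
    by rewrite -[in RHS](prednK s0) (exprS q s.-1); ring.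
  have := hTi l (leqnn l); rewrite /Tden_i /qpochs !big_cons !mulf_eq0 !negb_or => /and4P[_ _ + _].
  move=> /(hqk (s - l.+1)%N).
  have -> : q ^+ (2 + l) / c ^+ 2 * q ^+ (s - l.+1) = q / c ^+ 2 * q ^+ s.
    by rewrite -{2}(subnKC ls) [q ^+ (l.+1 + _)]exprD addSn (exprS q l.+1); ring.
  by apply; lia.
(* This product is the denominator in base q^2 at j = 0. *)
- apply: (@specializes_neq0 _ _ (qpoch ((q ^+ l.+1 * a / c) ^+ 2) (q ^+ 2) (m + n))); first by specialize_tac.
  have := hTmnj 0%N (leq0n m); rewrite /Tden_mnj /qpochs !big_cons !mulf_eq0 !negb_or subn0 => /and3P[_ + _].
  congr (qpoch _ _ _ != 0).
  have -> : (2 + 2 * l + 2 * 0 = l.+1 * 2)%N by rewrite muln0 addn0 [RHS]mulnC mulnS.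
  by rewrite exprM !exprMn exprVn.
Qed.

Theorem mainTheorem7 (R : realType) (q a c : R[i]) (l m n : nat)
  (hq : q != 0) (ha : a != 0) (hc : c != 0)
  (* no zero factor in a denominator of the left-hand side *)
  (hphi : forall k : nat, (k <= n)%N ->
     qpochs [:: q; q ^+ (1 + l) * a / c; q ^+ (1 + m + n) * a;
                - (q ^ (- n%:Z) * c)] q k != 0)
  (* no zero factor in a denominator of the prefactor *)
  (hpre_l : qpochs [:: q ^ (- l%:Z - 1) * c ^+ 2; - (q * a / c)] q l != 0)
  (hpre_n : qpochs [:: q ^+ (1 + m + n) * a; - (q / c)] q n != 0)
  (* no zero factor in a denominator of T_{i,j} *)
  (hTc : Tden_c q c != 0)
  (hTi : forall i : nat, (i <= l)%N -> Tden_i q a c l i != 0)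
  (hTj : forall j : nat, (j <= m)%N -> Tden_j q a c l m n j != 0)
  (hTmnj : forall j : nat, (j <= m)%N -> Tden_mnj q a c l m n j != 0) :
  phi43 n a c (q ^ (- n%:Z)) (- (q ^+ (1 + l + m + n) * a / c))
    (q ^+ (1 + l) * a / c) (q ^+ (1 + m + n) * a) (- (q ^ (- n%:Z) * c)) q q
  = qpochs [:: a; - (q ^ (- l%:Z) * c)] q l
    / qpochs [:: q ^ (- l%:Z - 1) * c ^+ 2; - (q * a / c)] q l
    * (qpochs [:: q ^+ (1 + m + n); - (q * a / c)] q n
       / qpochs [:: q ^+ (1 + m + n) * a; - (q / c)] q n)
    * \sum_(0 <= i < l.+1) \sum_(0 <= j < m.+1) T q a c l m n i j.
Proof. exact: double_sum_identity hTj hTmnj. Qed.
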